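(* Let $n_1\ge n_2\ge 1$ be integers, let $\sigma>0$, let $\theta^*\in\mathcal{M}^{n_1,n_2}$ be an anti-Monge matrix, and suppose that we observe $y=\theta^*+\varepsilon$, where $\varepsilon\sim\mathsf{subG}_{n_1\times n_2}(\sigma^2)$. Then the least-squares estimator $\hat\theta^{\mathsf{ls}}:=\operatorname{argmin}_{\theta\in\mathcal{M}^{n_1,n_2}}\|\theta-y\|_F^2$ satisfies $$\frac{1}{n_1n_2}\|\hat\theta^{\mathsf{ls}}-\theta^*\|_F^2\;\lesssim\;\left[\frac{\sigma^2}{n_2}+\left(\frac{\sigma^2V(\theta^* )}{n_1n_2}\right)^{2/3}\log(n_1)^{1/3}\log(n_2)^{2/3}\right]\wedge\sigma^2$$ with probability at least $1-\exp(-n_1)$. Moreover, the same bound holds in expectation, i.e. with the left-hand side replaced by $\mathbb{E}\big[\frac{1}{n_1n_2}\|\hat\theta^{\mathsf{ls}}-\theta^*\|_F^2\big]$.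
   Context: A matrix $\theta\in\mathbb{R}^{n_1\times n_2}$ is anti-Monge if $\theta_{i,j}+\theta_{k,\ell}\ge\theta_{i,\ell}+\theta_{k,j}$ for all $1\le i\le k\le n_1$, $1\le j\le\ell\le n_2$. The set of anti-Monge matrices (a closed convex cone) is denoted $\mathcal{M}=\mathcal{M}^{n_1,n_2}$. For $\theta\in\mathcal{M}$, $V(\theta):=\theta_{1,1}+\theta_{n_1,n_2}-\theta_{n_1,1}-\theta_{1,n_2}\ge 0$. A zero-mean random matrix $\varepsilon\in\mathbb{R}^{n_1\times n_2}$ satisfies $\varepsilon\sim\mathsf{subG}_{n_1\times n_2}(\sigma^2)$ if $\mathbb{E}[\exp(\mathrm{Tr}(M^\top\varepsilon))]\le\exp(\sigma^2\|M\|_F^2/2)$ for every $M\in\mathbb{R}^{n_1\times n_2}$. $\|\cdot\|_F$ is the Frobenius norm; $a\wedge b=\min(a,b)$; $a\lesssim b$ means $a\le Cb$ for a universal constant $C>0$ (independent of all parameters). *)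

(* Defs.v *)
From HB Require Import structures.
From mathcomp Require Import all_boot all_order all_algebra.
From mathcomp Require Import all_classical all_reals all_analysis.
From mathcomp Require Import ring lra.

Set Implicit Arguments.
Unset Strict Implicit.
Unset Printing Implicit Defensive.

Import Order.TTheory GRing.Theory Num.Theory.
Import numFieldNormedType.Exports.

Local Open Scope classical_set_scope.
Local Open Scope ring_scope.

Definition anti_monge (R : realType) (n1 n2 : nat) (A : 'M[R]_(n1, n2)) : Prop :=
  forall (i k : 'I_n1) (j l : 'I_n2), (i <= k)%N -> (j <= l)%N ->
    A i l + A k j <= A i j + A k l.

Definition frob (R : realType) (n1 n2 : nat) (A : 'M[R]_(n1, n2)) : R :=
  Num.sqrt (\sum_(i < n1) \sum_(j < n2) A i j ^+ 2).

Definition corner_variation (R : realType) (m1 m2 : nat)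
    (A : 'M[R]_(m1.+1, m2.+1)) : R :=
  A ord0 ord0 + A ord_max ord_max - A ord_max ord0 - A ord0 ord_max.

(* [v] is the variance proxy, i.e. the sigma^2 of the usual notation. *)
Definition subG (d : measure_display) (T : measurableType d) (R : realType)
    (P : probability T R) (n1 n2 : nat) (eps : T -> 'M[R]_(n1, n2)) (v : R) : Prop :=
  [/\ forall i j, measurable_fun [set: T] (fun w => eps w i j),
      forall i j, P.-integrable [set: T] (fun w => (eps w i j)%:E),
      forall i j, ('E_P[fun w => eps w i j] = 0)%E
    & forall M : 'M[R]_(n1, n2),
        ('E_P[fun w => expR (\tr (M^T *m eps w))]
           <= (expR (v * frob M ^+ 2 / 2))%:E)%E].

Definition is_least_squares (R : realType) (n1 n2 : nat)
    (y t : 'M[R]_(n1, n2)) : Prop :=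
  anti_monge t /\
  forall u, anti_monge u -> frob (t - y) ^+ 2 <= frob (u - y) ^+ 2.

(* The default value 0 is never used: see [ls_least_squares]. *)
Definition ls (R : realType) (n1 n2 : nat) (y : 'M[R]_(n1, n2)) : 'M[R]_(n1, n2) :=
  xget 0 [set t | is_least_squares y t].

Lemma frob_sqr (R : realType) (n1 n2 : nat) (A : 'M[R]_(n1, n2)) :
  frob A ^+ 2 = \sum_(i < n1) \sum_(j < n2) A i j ^+ 2.
Proof.
by rewrite sqr_sqrtr //; apply: sumr_ge0 => i _; apply: sumr_ge0 => j _; exact: sqr_ge0.
Qed.

Lemma frob_entry (R : realType) (n1 n2 : nat) (A : 'M[R]_(n1, n2)) i j :
  A i j ^+ 2 <= frob A ^+ 2.
Proof.
rewrite frob_sqr (bigD1 i) //= (bigD1 j) //= -addrA lerDl addr_ge0 //.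
  by apply: sumr_ge0 => *; exact: sqr_ge0.
by apply: sumr_ge0 => *; apply: sumr_ge0 => *; exact: sqr_ge0.
Qed.

Lemma least_squares_unique (R : realType) (n1 n2 : nat) (y s t : 'M[R]_(n1, n2)) :
  is_least_squares y s -> is_least_squares y t -> s = t.
Proof.
move=> [sM smin] [tM tmin].
have mM : anti_monge (2^-1 *: (s + t)).
  move=> i k j l ik jl; rewrite !mxE.
  have := sM _ _ _ _ ik jl; have := tM _ _ _ _ ik jl; lra.
have par : frob (2^-1 *: (s + t) - y) ^+ 2 + 4^-1 * frob (s - t) ^+ 2
         = 2^-1 * frob (s - y) ^+ 2 + 2^-1 * frob (t - y) ^+ 2.
  rewrite !frob_sqr !mulr_sumr -!big_split /=; apply: eq_bigr => i _.
  rewrite !mulr_sumr -!big_split /=; apply: eq_bigr => j _.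
  by rewrite !mxE; field.
have st0 : frob (s - t) ^+ 2 <= 0.
  have := smin _ mM; have := tmin _ mM; lra.
apply/matrixP => i j; apply/eqP; rewrite -subr_eq0 -sqrf_eq0.
have := le_trans (frob_entry (s - t) i j) st0.
by rewrite !mxE => h; rewrite eq_le h sqr_ge0.
Qed.

Lemma least_squares_exists (R : realType) (n1 n2 : nat) (y : 'M[R]_(n1, n2)) :
  exists t, is_least_squares y t.
Proof.
pose g (v : 'rV[R]_(n1 * n2)) := frob (vec_mx v - y) ^+ 2.
have vc i j : continuous (fun v : 'rV[R]_(n1 * n2) => vec_mx v i j).
  rewrite (_ : (fun _ => _) = fun v : 'rV[R]_(n1 * n2) => v ord0 (mxvec_index i j)).
    exact: coord_continuous.
  by apply/funext => u; rewrite mxE.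
have gc : continuous g.
  rewrite /g; under eq_fun do rewrite frob_sqr.
  apply: continuous_big => [|i _]; first exact: add_continuous.
  apply: continuous_big => [|j _]; first exact: add_continuous.
  rewrite (_ : (fun _ => _) = fun u : 'rV[R]_(n1 * n2) => (vec_mx u i j - y i j) ^+ 2).
    move=> v; apply: (@continuous_comp _ _ _ (fun u => vec_mx u i j - y i j) (fun z : R => z ^+ 2)).
      by apply: continuousB; [exact: vc | exact: cst_continuous].
    exact: exprn_continuous.
  by apply/funext => u; rewrite !mxE.
pose A := [set v : 'rV[R]_(n1 * n2) | anti_monge (vec_mx v) /\ g v <= frob y ^+ 2].
have A0 : A 0.
  split; first by move=> *; rewrite linear0 !mxE.
  rewrite /g linear0 sub0r !frob_sqr le_eqVlt; apply/orP; left; apply/eqP.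
  by apply: eq_bigr => i _; apply: eq_bigr => j _; rewrite mxE sqrrN.
have clA : closed A.
  rewrite (_ : A = (\bigcap_(q in [set q : ('I_n1 * 'I_n1) * ('I_n2 * 'I_n2) |
        (q.1.1 <= q.1.2)%N /\ (q.2.1 <= q.2.2)%N])
      (fun v => vec_mx v q.1.1 q.2.2 + vec_mx v q.1.2 q.2.1
         - (vec_mx v q.1.1 q.2.1 + vec_mx v q.1.2 q.2.2)) @^-1` [set x : R | x <= 0])
      `&` g @^-1` [set x | x <= frob y ^+ 2]).
    apply: closedI.
      apply: closed_bigI => q _; apply: preimage_closed => [v _|]; last exact: closed_le.
      apply: (@continuousB _ _ _ (fun v => vec_mx v q.1.1 q.2.2 + vec_mx v q.1.2 q.2.1)
        (fun v => vec_mx v q.1.1 q.2.1 + vec_mx v q.1.2 q.2.2)).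
        by apply: (@continuousD _ _ _ (fun v => vec_mx v q.1.1 q.2.2)
          (fun v => vec_mx v q.1.2 q.2.1)); exact: vc.
      by apply: (@continuousD _ _ _ (fun v => vec_mx v q.1.1 q.2.1)
        (fun v => vec_mx v q.1.2 q.2.2)); exact: vc.
    by apply: preimage_closed => [v _|]; [exact: gc | exact: closed_le].
  apply/seteqP; split=> v /= [vM gv]; split=> //.
    by move=> [[i k] [j l]] /= [ik jl]; rewrite subr_le0; exact: vM.
  by move=> i k j l ik jl; rewrite -subr_le0; exact: (vM ((i, k), (j, l))).
have bdA : compact A.
  pose r := frob y ^+ 2 + 1.
  pose B := [set v : 'rV[R]_(n1 * n2) | forall p, (`[- r - mxvec (- y) ord0 p, r - mxvec (- y) ord0 p]%classic) (v ord0 p)].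
  apply: (@subclosed_compact _ A B) => //.
    apply: (@rV_compact _ _ (fun p => `[- r - mxvec (- y) ord0 p, r - mxvec (- y) ord0 p]%classic)).
    by move=> p; exact: segment_compact.
  move=> v [_ gv] p /=; case/mxvec_indexP: p => i j.
  rewrite mxvecE in_itv /=.
  have := le_trans (frob_entry (vec_mx v - y) i j) gv.
  rewrite !mxE => h; rewrite /r; have := sqr_ge0 (frob y); nra.
have [v] := EVT_min_rV (ex_intro _ _ A0) bdA (continuous_subspaceT gc).
rewrite inE => -[vM gv] vmin.
exists (vec_mx v); split=> // u uM; rewrite -/(g v).
have [uy|uy] := leP (frob (u - y) ^+ 2) (frob y ^+ 2).
  have := vmin (mxvec u); rewrite /g mxvecK; apply.
  by rewrite inE; split; rewrite /g mxvecK.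
exact: le_trans gv (ltW uy).
Qed.

Lemma ls_least_squares (R : realType) (n1 n2 : nat) (y t : 'M[R]_(n1, n2)) :
  is_least_squares y t <-> t = ls y.
Proof.
have lsP : is_least_squares y (ls y) by apply: xgetPex; exact: least_squares_exists.
by split=> [/least_squares_unique|->//]; exact.
Qed.

(* Main.v *)
(* The least-squares error [h = ls y - theta] satisfies [|h|^2 <= <eps, h>]. Expand [eps] and [h] in
   a tensor Haar basis adapted to dyadic splittings of the rows and of the columns. An anti-Monge
   matrix has nonnegative coefficients against products of non-constant Haar vectors, and by
   telescoping the sum of those at scale [(a, b)] is at most its product with the difference of two
   probability vectors in each variable, scaled by [sqrt (2 ^ (a + b))]. That product is at most
   [sqrt (2 ^ (a + b)) V] for [theta], and differs by [O(|h|)] for [ls y], so no a priori bound on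
   [V (ls y)] is needed. Thresholding the noise at [4 sigma (s - a - b)] on the scales [a + b < s]
   and not at all elsewhere bounds [|h|^2] by [sigma^2 n1], [sigma V 2^(s/2) log n2] and a sum of
   squared excesses of the noise, whose exponential moments follow from sub-Gaussianity by
   writing [exp (z^2 / 4)] as a mixture of [exp (k z)]; it has size
   [sigma^2 (n1 + n1 n2 2^-s log n2)]. The optimal [s] gives the rate, and [log n2] is at most
   [(log n1)^(1/3) (log n2)^(2/3)]. *)
Require Import Defs.
From HB Require Import structures.
From mathcomp Require Import all_boot all_order all_algebra.
From mathcomp Require Import all_classical all_reals all_analysis.
From mathcomp Require Import measurable_realfun.
From mathcomp Require Import ring lra zify.
Set Implicit Arguments.
Unset Strict Implicit.
Unset Printing Implicit Defensive.
Import Order.TTheory GRing.Theory Num.Theory.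
Import numFieldNormedType.Exports.
Local Open Scope classical_set_scope.
Local Open Scope ring_scope.

(** * The dual cone of antitone vectors *)

Definition antitone (R : realType) (n : nat) (f : 'I_n -> R) : Prop :=
  forall i k : 'I_n, (i <= k)%N -> f k <= f i.

(** Constants of both signs are antitone, so a dual vector sums to zero; by Abel summation, duality
    means that moreover all its partial sums are nonnegative. *)
Definition dual (R : realType) (n : nat) (u : 'I_n -> R) : Prop :=
  forall f, antitone f -> 0 <= \sum_i u i * f i.

Definition prob_vec (R : realType) (n : nat) (u : 'I_n -> R) : Prop :=
  (forall i, 0 <= u i) /\ \sum_i u i = 1.

Lemma dualD (R : realType) (n : nat) (u v : 'I_n -> R) :
  dual u -> dual v -> dual (fun i => u i + v i).
Proof.
move=> du dv f af; under eq_bigr do rewrite mulrDl.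
by rewrite big_split addr_ge0 ?du ?dv.
Qed.

Lemma dualZ (R : realType) (n : nat) (c : R) (u : 'I_n -> R) :
  0 <= c -> dual u -> dual (fun i => c * u i).
Proof.
move=> c0 du f af; under eq_bigr do rewrite -mulrA.
by rewrite -mulr_sumr mulr_ge0 ?du.
Qed.

Lemma dual_sum (R : realType) (n : nat) (I : finType) (P : pred I) (u : I -> 'I_n -> R) :
  (forall i, P i -> dual (u i)) -> dual (fun k => \sum_(i | P i) u i k).
Proof.
move=> du f af; under eq_bigr do rewrite mulr_suml.
by rewrite exchange_big sumr_ge0 // => i Pi; exact: du.
Qed.

Definition bil (R : realType) (n1 n2 : nat) (u : 'I_n1 -> R) (A : 'M[R]_(n1, n2))
    (v : 'I_n2 -> R) : R :=
  \sum_i \sum_j u i * A i j * v j.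

(** For [i <= k] the anti-Monge inequality makes [A i j - A k j] antitone in [j]. Pairing with [v]
    shows that [\sum_j A i j * v j] is antitone in [i], and [u] is dual. *)
Lemma bil_ge0 (R : realType) (n1 n2 : nat) (A : 'M[R]_(n1, n2)) u v :
  anti_monge A -> dual u -> dual v -> 0 <= bil u A v.
Proof.
move=> mA du dv; rewrite /bil.
under eq_bigr => i _ do (under eq_bigr => j _ do rewrite -mulrA (mulrC (A i j)); rewrite -mulr_sumr).
apply: du => i k ik; rewrite -subr_ge0 -sumrB.
under eq_bigr do rewrite -mulrBr.
apply: dv => j l jl; have := mA i k j l ik jl; lra.
Qed.

(** Under the product coupling of [L] and [U], the pairing with [f] is the mean of [f i - f k] over
    pairs with [i <= k]: mass is transported rightwards. *)
Lemma prob_vec_sub_dual (R : realType) (n : nat) (L U : 'I_n -> R) :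
  prob_vec L -> prob_vec U -> (forall i k, L i != 0 -> U k != 0 -> (i <= k)%N) ->
  dual (fun i => L i - U i).
Proof.
move=> [L0 L1] [U0 U1] LU f af.
under eq_bigr do rewrite mulrBl.
rewrite sumrB subr_ge0.
have -> : \sum_i L i * f i = \sum_i \sum_k L i * U k * f i.
  apply: eq_bigr => i _; under eq_bigr do rewrite mulrAC.
  by rewrite -mulr_sumr U1 mulr1.
have -> : \sum_i U i * f i = \sum_i \sum_k L i * U k * f k.
  rewrite exchange_big; apply: eq_bigr => k _; under eq_bigr do rewrite -mulrA.
  by rewrite -mulr_suml L1 mul1r.
apply: ler_sum => i _; apply: ler_sum => k _.
have [->|Li] := eqVneq (L i) 0; first by rewrite !mul0r.
have [->|Uk] := eqVneq (U k) 0; first by rewrite mulr0 !mul0r.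
by rewrite ler_wpM2l ?mulr_ge0 // af // LU.
Qed.

(** * Concatenation of vectors on adjacent blocks of indices *)

Definition glue (R : realType) (p q : nat) (u : 'I_p -> R) (v : 'I_q -> R)
    (k : 'I_(p + q)) : R :=
  match fintype.split k with inl i => u i | inr j => v j end.

Lemma glue_l (R : realType) (p q : nat) (u : 'I_p -> R) (v : 'I_q -> R) i :
  glue u v (lshift q i) = u i.
Proof. by rewrite /glue; case: split_ordP => j => [/lshift_inj->|/eqP] //; rewrite eq_lrshift. Qed.

Lemma glue_r (R : realType) (p q : nat) (u : 'I_p -> R) (v : 'I_q -> R) i :
  glue u v (rshift p i) = v i.
Proof. by rewrite /glue; case: split_ordP => j => [/eqP|/rshift_inj->] //; rewrite eq_rlshift. Qed.

Lemma sum_glue (R : realType) (p q : nat) (u : 'I_p -> R) (v : 'I_q -> R) (f : 'I_(p + q) -> R) :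
  \sum_k glue u v k * f k
  = \sum_i u i * f (lshift q i) + \sum_j v j * f (rshift p j).
Proof.
rewrite big_split_ord; congr (_ + _); apply: eq_bigr => i _; first by rewrite glue_l.
by rewrite glue_r.
Qed.

Lemma dual_glue (R : realType) (p q : nat) (u : 'I_p -> R) (v : 'I_q -> R) :
  dual u -> dual v -> dual (glue u v).
Proof.
move=> du dv f af; rewrite sum_glue addr_ge0 //.
  by apply: (du (fun i => f (lshift q i))) => i k ik; exact: af.
by apply: (dv (fun j => f (rshift p j))) => i k ik; apply: af; rewrite /= leq_add2l.
Qed.

Lemma dual0 (R : realType) (n : nat) : dual (fun _ : 'I_n => 0 : R).
Proof. by move=> f _; under eq_bigr do rewrite mul0r; rewrite sumr_const mul0rn. Qed.

Lemma prob_vec_gluel (R : realType) (p q : nat) (u : 'I_p -> R) :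
  prob_vec u -> prob_vec (glue u (fun _ : 'I_q => 0)).
Proof.
move=> [u0 u1]; split=> [k|]; first by rewrite /glue; case: fintype.split.
rewrite big_split_ord /= (eq_bigr u) => [|i _]; last by rewrite glue_l.
by rewrite u1 big1 ?addr0 // => j _; rewrite glue_r.
Qed.

Lemma prob_vec_gluer (R : realType) (p q : nat) (u : 'I_q -> R) :
  prob_vec u -> prob_vec (glue (fun _ : 'I_p => 0) u).
Proof.
move=> [u0 u1]; split=> [k|]; first by rewrite /glue; case: fintype.split.
rewrite big_split_ord /= [X in _ + X](eq_bigr u) => [|i _]; last by rewrite glue_r.
by rewrite u1 big1 ?add0r // => j _; rewrite glue_l.
Qed.

(** * Haar systems *)

(* [sc i] is the height in a balanced binary tree of the interval supporting
   the [i]-th Haar vector; [i0] is the index of the constant vector. *)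
Record haar_system (R : realType) (k n : nat) (H : 'M[R]_n) (sc : 'I_n -> nat) : Prop :=
  HaarSystem {
    haar_ortho : H *m H^T = 1%:M;
    haar_le : forall i, (sc i <= k)%N;
    haar_card : forall a, (#|[pred i | sc i == a]| <= 2 ^ (k - a))%N;
    haar_const : exists i0, forall i, (sc i == k) = (i == i0)
      /\ (i = i0 -> forall j, H i j = (Num.sqrt n%:R)^-1);
    haar_dual : forall i, (sc i < k)%N -> dual (H i);
    haar_envelope : forall a, (a < k)%N -> exists L U : 'I_n -> R,
      [/\ prob_vec L, prob_vec U, \sum_i L i ^+ 2 <= 2 / 2 ^+ a, \sum_i U i ^+ 2 <= 2 / 2 ^+ a
        & dual (fun j => Num.sqrt (2 ^+ a) * (L j - U j) - \sum_(i | sc i == a) H i j)] }.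

(** A singleton fits the window [n <= 2 ^ k <= 2 * n] for [k = 0] and for [k = 1], so a leaf may sit
    at height 1. No vector then has scale 0, and [L = U] gives the zero envelope. *)
Lemma haar_one (R : realType) (k : nat) : (k <= 1)%N ->
  @haar_system R k 1 1%:M (fun=> k).
Proof.
move=> k1; split.
- by rewrite mul1mx trmx1.
- by [].
- move=> a; apply: leq_trans (max_card _) _; by rewrite card_ord expn_gt0.
- exists ord0 => i; rewrite eqxx ord1; split=> // _ j.
  by rewrite ord1 mxE sqrtr1 invr1.
- by move=> i; rewrite ltnn.
- move=> a ak; exists (fun=> 1), (fun=> 1).
  have pv : prob_vec (fun _ : 'I_1 => 1 : R) by split; rewrite ?big_ord1.
  have a0 : a = 0%N by lia.
  split => //; rewrite ?big_ord1 ?a0 ?expr0 ?expr1n ?divr1 ?ler1n //.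
  move=> f _; rewrite big_ord1 big1 => [|i]; last by move/eqP; lia.
  by rewrite subrr mulr0 subr0 mul0r.
Qed.

(* The two halves keep their non-constant Haar vectors; the plane spanned by
   their constant vectors is rotated to split off the constant vector on the union. *)
Lemma haar_merge (R : realType) (k p q : nat) (Hp : 'M[R]_p) (Hq : 'M[R]_q) sp sq :
  (0 < p)%N -> (0 < q)%N -> (p <= 2 ^ k <= 2 * p)%N -> (q <= 2 ^ k <= 2 * q)%N ->
  haar_system k Hp sp -> haar_system k Hq sq ->
  exists (H : 'M[R]_(p + q)) (sc : 'I_(p + q) -> nat), haar_system k.+1 H sc.
Proof.
move=> p0 q0 /andP[pk kp] /andP[qk kq].
move=> [Op lp cp [ip ipP] dp ep] [Oq lq cq [iq iqP] dq eq_].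
have Hip j : Hp ip j = (Num.sqrt p%:R)^-1 by apply: (ipP ip).2.
have Hiq j : Hq iq j = (Num.sqrt q%:R)^-1 by apply: (iqP iq).2.
have sp0 : 0 < Num.sqrt p%:R :> R by rewrite sqrtr_gt0 ltr0n.
have sq0 : 0 < Num.sqrt q%:R :> R by rewrite sqrtr_gt0 ltr0n.
have sn0 : 0 < Num.sqrt (p + q)%:R :> R by rewrite sqrtr_gt0 ltr0n addn_gt0 p0.
have sp2 : Num.sqrt p%:R ^+ 2 = p%:R :> R by rewrite sqr_sqrtr.
have sq2 : Num.sqrt q%:R ^+ 2 = q%:R :> R by rewrite sqr_sqrtr.
have sn2 : Num.sqrt (p + q)%:R ^+ 2 = p%:R + q%:R :> R by rewrite sqr_sqrtr // natrD.
move: Hip Hiq sp0 sq0 sn0 sp2 sq2 sn2.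
set x := Num.sqrt p%:R; set y := Num.sqrt q%:R; set z := Num.sqrt (p + q)%:R.
move=> Hip Hiq x0 y0 z0 x2 y2 z2.
have xn0 : x != 0 by rewrite gt_eqF.
have yn0 : y != 0 by rewrite gt_eqF.
have zn0 : z != 0 by rewrite gt_eqF.
have pR0 : p%:R != 0 :> R by rewrite pnatr_eq0 -lt0n.
have qR0 : q%:R != 0 :> R by rewrite pnatr_eq0 -lt0n.
have xyz : x ^+ 2 + y ^+ 2 = z ^+ 2 by rewrite x2 y2 z2.
(* Row [i] is [A i] times row [f i] of [Hp] on the left block and [B i] times row [g i] of [Hq] on
   the right one. The slot of [ip] receives the new constant vector, the slot of [iq] the rotated
   difference of the two old ones; any other row has weight 0 on the opposite block, where its index
   is a dummy. *)
pose f (i : 'I_(p + q)) := if fintype.split i is inl u then u else ip.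
pose g (i : 'I_(p + q)) := if fintype.split i is inr v then v else iq.
pose A (i : 'I_(p + q)) : R := match fintype.split i with
  inl u => if u == ip then x / z else 1 | inr v => if v == iq then y / z else 0 end.
pose B (i : 'I_(p + q)) : R := match fintype.split i with
  inl u => if u == ip then y / z else 0 | inr v => if v == iq then - (x / z) else 1 end.
pose sc (i : 'I_(p + q)) : nat := match fintype.split i with
  inl u => if u == ip then k.+1 else sp u | inr v => if v == iq then k else sq v end.
pose row i := glue (fun j => A i * Hp (f i) j) (fun j => B i * Hq (g i) j).
pose H : 'M[R]_(p + q) := \matrix_(i, j) row i j.
have sl u : fintype.split (lshift q u) = inl u by exact: (unsplitK (inl u)).
have sr v : fintype.split (rshift p v) = inr v by exact: (unsplitK (inr v)).
have spk u : (sp u == k) = (u == ip) by have [] := ipP u.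
have sqk v : (sq v == k) = (v == iq) by have [] := iqP v.
have oP u v : \sum_j Hp u j * Hp v j = (u == v)%:R.
  have /matrixP/(_ u v) := Op; rewrite !mxE => <-; apply: eq_bigr => j _; by rewrite mxE.
have oQ u v : \sum_j Hq u j * Hq v j = (u == v)%:R.
  have /matrixP/(_ u v) := Oq; rewrite !mxE => <-; apply: eq_bigr => j _; by rewrite mxE.
pose L := glue (fun _ : 'I_p => (p%:R)^-1 : R) (fun _ : 'I_q => 0).
pose U := glue (fun _ : 'I_p => 0 : R) (fun _ : 'I_q => (q%:R)^-1).
have unif m : (0 < m)%N -> prob_vec (fun _ : 'I_m => (m%:R)^-1 : R).
  move=> m0; split=> [i|]; first by rewrite invr_ge0.
  by rewrite sumr_const card_ord -[LHS]mulr_natl divff // pnatr_eq0 -lt0n.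
have pL : prob_vec L by apply/prob_vec_gluel/unif.
have pU : prob_vec U by apply/prob_vec_gluer/unif.
have gap (u : 'I_p -> R) (v : 'I_q -> R) : prob_vec u -> prob_vec v ->
    dual (fun j => glue u (fun=> 0) j - glue (fun=> 0) v j).
  move=> pu pv; apply: prob_vec_sub_dual => [||i j].
  - exact: prob_vec_gluel.
  - exact: prob_vec_gluer.
  rewrite /glue; case: split_ordP => i' ->; last by rewrite eqxx.
  case: split_ordP => j' ->; first by rewrite eqxx.
  move=> _ _ /=; by rewrite (leq_trans (ltnW (ltn_ord i'))) ?leq_addr.
(* Since [y / (z * x) = (x * y / z) / x ^ 2], the new difference vector is a multiple of the uniform
   law on the left block minus that on the right block. *)
have top : row (rshift p iq) = fun j => x * y / z * (L j - U j).
  apply/funext => j; rewrite /row /A /B /f /g sr eqxx /L /U /glue.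
  case: fintype.split => l; rewrite ?Hip ?Hiq ?sub0r ?subr0 -?x2 -?y2; field; by rewrite ?xn0 ?yn0 ?zn0.
exists H, sc; split.
- apply/matrixP => i j; rewrite !mxE.
  have -> : \sum_l H i l * H^T l j = A i * A j * (f i == f j)%:R + B i * B j * (g i == g j)%:R.
    rewrite -oP -oQ !mulr_sumr big_split_ord; congr (_ + _); apply: eq_bigr => l _;
      rewrite !mxE /row ?glue_l ?glue_r; ring.
  have simp := (@mulr1 R, @mulr0 R, @mul0r R, @mul1r R, @addr0 R, @add0r R).
  rewrite /A /B /f /g; case: (split_ordP i) => u ->; case: (split_ordP j) => v ->;
    rewrite ?sl ?sr ?eq_lrshift ?eq_rlshift ?(inj_eq (@lshift_inj _ _)) ?(inj_eq (@rshift_inj _ _)) ?eqxx.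
  + have [->|ui] := eqVneq u ip; [have [_|_] := eqVneq v ip | have [->|_] := eqVneq v ip; rewrite ?(negPf ui)]; rewrite /= ?eqxx ?simp //.
    by rewrite -!expr2 !expr_div_n -mulrDl xyz divff // expf_neq0.
  + have [_|_] := eqVneq u ip; have [_|_] := eqVneq v iq; rewrite /= ?eqxx ?simp //.
    by field.
  + have [_|_] := eqVneq u iq; have [_|_] := eqVneq v ip; rewrite /= ?eqxx ?simp //.
    by field.
  + have [->|ui] := eqVneq u iq; [have [_|_] := eqVneq v iq | have [->|_] := eqVneq v iq; rewrite ?(negPf ui)]; rewrite /= ?eqxx ?simp //.
    by rewrite -!expr2 sqrrN !expr_div_n -mulrDl addrC xyz divff // expf_neq0.
- move=> i; rewrite /sc; case: fintype.split => u; case: ifP => // _; exact: leqW.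
- move=> a; rewrite -sum1_card big_split_ord /=.
  have cl (P : pred 'I_p) m : (#|P| <= m)%N -> (\sum_(i | P i) 1 <= m)%N by rewrite sum1_card.
  have cr (P : pred 'I_q) m : (#|P| <= m)%N -> (\sum_(i | P i) 1 <= m)%N by rewrite sum1_card.
  have [ak|ka] := leqP a k.
    rewrite subSn // expnS mul2n -addnn; apply: leq_add.
      apply: cl; apply: leq_trans (cp a); apply: subset_leq_card; apply/fintype.subsetP => u.
      rewrite unfold_in /= unfold_in /= /sc sl; case: ifP => // _ /eqP ka; by rewrite -ka ltnn in ak.
    apply: cr; apply: leq_trans (cq a); apply: subset_leq_card; apply/fintype.subsetP => u.
    rewrite unfold_in /= unfold_in /= /sc sr; case: ifP => //; rewrite -sqk => /eqP h /eqP <-; rewrite unfold_in /= h eqxx //.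
  have -> : (k.+1 - a = 0)%N by apply/eqP; rewrite subn_eq0.
  rewrite [X in (_ + X)%N]big1 ?addn0; last first.
    by move=> v; rewrite unfold_in /= /sc sr; case: ifP => _ /eqP va; move: ka; rewrite -va ltnNge ?leqnn ?lq.
  apply: cl; apply: leq_trans (eq_leq (card1 ip)); apply: subset_leq_card; apply/fintype.subsetP => u.
  rewrite unfold_in /= unfold_in /= /sc sl; case: ifP => // _ /eqP ua; move: ka; by rewrite -ua ltnNge lp.
- exists (lshift q ip) => i; split.
    rewrite /sc; case: (split_ordP i) => u ->; rewrite ?sl ?sr ?eq_rlshift ?(inj_eq (@lshift_inj _ _)).
      by case: ifP => [_|uip]; rewrite ?eqxx //; rewrite ltn_eqF // ltnS lp.
    by case: ifP => [_|uip]; rewrite ltn_eqF // ltnS lq.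
  move=> -> j; rewrite mxE /row /A /B /f /g sl eqxx /glue -/z.
  by case: fintype.split => l; rewrite ?Hip ?Hiq; field; rewrite ?xn0 ?yn0 ?zn0.
- move=> i; have -> : H i = row i by apply/funext => j; rewrite mxE.
  case: (split_ordP i) => u ->; rewrite /sc ?sl ?sr.
    case: ifP => [|uip _]; first by rewrite ltnn.
    rewrite /row /A /B /f /g sl uip; apply: dual_glue.
      apply: dualZ => //; apply: dp; rewrite ltn_neqAle lp andbT spk uip //.
    have -> : (fun j => 0 * Hq iq j) = (fun=> 0) by apply/funext => j; rewrite mul0r.
    exact: dual0.
  case: ifP => [/eqP -> _|uiq _].
    rewrite top; apply: dualZ; last by apply: gap; exact: unif.
    by rewrite divr_ge0 ?mulr_ge0 // ltW.
  rewrite /row /A /B /f /g sr uiq; apply: dual_glue.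
    have -> : (fun j => 0 * Hp ip j) = (fun=> 0) by apply/funext => j; rewrite mul0r.
    exact: dual0.
  by apply: dualZ => //; apply: dq; rewrite ltn_neqAle lq andbT sqk uiq.
- move=> a; rewrite ltnS leq_eqVlt => /orP[/eqP ->|ak]; last first.
    have [Lp [Up [pLp pUp sLp sUp dLp]]] := ep a ak.
    have [Lq [Uq [pLq pUq sLq sUq dLq]]] := eq_ a ak.
    (* Telescoping: only the [L] of the left block and the [U] of the right block are kept. The
       dropped [Up - Lq] moves mass from left to right, hence is dual, so the envelope does not grow
       with the number of blocks. *)
    exists (glue Lp (fun=> 0)), (glue (fun=> 0) Uq); split.
    + exact: prob_vec_gluel.
    + exact: prob_vec_gluer.
    + rewrite big_split_ord /= [X in _ + X]big1 ?addr0 => [|j _]; last by rewrite glue_r expr0n.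
      by under eq_bigr do rewrite glue_l.
    + rewrite big_split_ord /= [X in X + _]big1 ?add0r => [|j _]; last by rewrite glue_l expr0n.
      by under eq_bigr do rewrite glue_r.
    have -> : (fun j => Num.sqrt (2 ^+ a) * (glue Lp (fun=> 0) j - glue (fun=> 0) Uq j)
               - \sum_(i | sc i == a) H i j)
       = fun j => glue (fun j => Num.sqrt (2 ^+ a) * (Lp j - Up j) - \sum_(i | sp i == a) Hp i j)
                   (fun j => Num.sqrt (2 ^+ a) * (Lq j - Uq j) - \sum_(i | sq i == a) Hq i j) j
           + Num.sqrt (2 ^+ a) * (glue Up (fun=> 0) j - glue (fun=> 0) Lq j).
      apply/funext => j; rewrite big_split_ord /=.
      have -> : \sum_(i | sc (lshift q i) == a) H (lshift q i) j
          = glue (fun j => \sum_(i | sp i == a) Hp i j) (fun=> 0) j.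
        rewrite (eq_big (fun i => sp i == a) (fun i => glue (Hp i) (fun=> 0) j)).
        * by rewrite /glue; case: fintype.split => // l; rewrite big1.
        * by move=> u; rewrite /sc sl; case: ifP => //; rewrite -spk => /eqP ->; rewrite !gtn_eqF // ltnW.
        * move=> u; rewrite /sc sl mxE /row /A /B /f /g sl.
          case: ifP => [_ /eqP|_ _]; first by move=> ka; rewrite -ka ltnNge leqnSn in ak.
          by rewrite /glue; case: fintype.split => l; rewrite ?mul1r ?mul0r.
      have -> : \sum_(i | sc (rshift p i) == a) H (rshift p i) j
          = glue (fun=> 0) (fun j => \sum_(i | sq i == a) Hq i j) j.
        rewrite (eq_big (fun i => sq i == a) (fun i => glue (fun=> 0) (Hq i) j)).
        * by rewrite /glue; case: fintype.split => // l; rewrite big1.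
        * by move=> u; rewrite /sc sr; case: ifP => //; rewrite -sqk => /eqP ->.
        * move=> u; rewrite /sc sr mxE /row /A /B /f /g sr.
          case: ifP => [_ /eqP|_ _]; first by move=> ka; rewrite -ka ltnn in ak.
          by rewrite /glue; case: fintype.split => l; rewrite ?mul1r ?mul0r.
      by rewrite /glue; case: fintype.split => l; ring.
    apply: dualD; first exact: dual_glue.
    by apply: dualZ; [exact: sqrtr_ge0 | exact: gap].
  have k2 : 0 < 2 ^+ k :> R by rewrite exprn_gt0.
  exists L, U; split=> //.
  + rewrite big_split_ord /= [X in _ + X]big1 ?addr0 => [|j _]; last by rewrite /L glue_r expr0n.
    under eq_bigr do rewrite /L glue_l.
    rewrite sumr_const card_ord -[leLHS]mulr_natl expr2 mulrA divff // mul1r.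
    by rewrite ler_pdivlMr // mulrC ler_pdivrMr ?ltr0n // -natrX -natrM ler_nat.
  + rewrite big_split_ord /= [X in X + _]big1 ?add0r => [|j _]; last by rewrite /U glue_l expr0n.
    under eq_bigr do rewrite /U glue_r.
    rewrite sumr_const card_ord -[leLHS]mulr_natl expr2 mulrA divff // mul1r.
    by rewrite ler_pdivlMr // mulrC ler_pdivrMr ?ltr0n // -natrX -natrM ler_nat.
  have -> : (fun j => Num.sqrt (2 ^+ k) * (L j - U j) - \sum_(i | sc i == k) H i j)
     = fun j => (Num.sqrt (2 ^+ k) - x * y / z) * (L j - U j).
    apply/funext => j; rewrite (big_pred1 (rshift p iq)) => [|i].
      by rewrite mxE top mulrBl.
    rewrite /sc /=; case: (split_ordP i) => u ->; rewrite ?sl ?sr ?eq_lrshift ?(inj_eq (@rshift_inj _ _)).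
      by case: ifP => [_|]; rewrite ?spk // gtn_eqF.
    by case: ifP => [_|]; rewrite ?sqk ?eqxx.
  apply: dualZ; last by apply: gap; exact: unif.
  (* The square of [x * y / z] is [p * q / (p + q)], at most [p] and hence at most [2 ^ k]. *)
  rewrite subr_ge0 -(ler_pXn2r (n := 2)) ?nnegrE ?sqrtr_ge0 //; last first.
    by rewrite divr_ge0 ?mulr_ge0 // ltW.
  rewrite sqr_sqrtr ?(ltW k2) // expr_div_n exprMn ler_pdivrMr ?exprn_gt0 // x2 y2 z2.
  have pk' : p%:R <= 2 ^+ k :> R by rewrite -natrX ler_nat.
  have : 0 <= p%:R :> R by []. have : 0 <= q%:R :> R by [].
  by nra.
Qed.

Lemma haar_exists (R : realType) (k n : nat) : (0 < n)%N -> (n <= 2 ^ k <= 2 * n)%N ->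
  exists (H : 'M[R]_n) (sc : 'I_n -> nat), haar_system k H sc.
Proof.
elim: k n => [|k IH] n n0 /andP[nk kn].
  have -> : n = 1%N by lia.
  by exists 1%:M, (fun=> 0%N); exact: haar_one.
(* A singleton cannot be halved; the window then forces [k.+1 = 1], which [haar_one] covers. *)
have [n1|n1] := leqP n 1.
  have -> : n = 1%N by lia.
  have k0 : k = 0%N by case: k kn {IH nk} => // k; rewrite !expnS; have := expn_gt0 2 k; lia.
  by exists 1%:M, (fun=> k.+1); apply: haar_one; rewrite k0.
have [p [q [-> p0 q0 pk qk]]] : exists p q, [/\ n = (p + q)%N, (0 < p)%N, (0 < q)%N,
    (p <= 2 ^ k <= 2 * p)%N & (q <= 2 ^ k <= 2 * q)%N].
  (* For odd [n] the lower half needs [2 ^ k <= n - 1], which follows from [2 ^ k <= n] once [2 ^ k]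
     is even; hence the case split on [k]. *)
  exists n./2, (n - n./2)%N; have := expn_gt0 2 k; case: k kn nk {IH} => [|k]; rewrite ?expnS; split; lia.
have [Hp [sp hp]] := IH p p0 pk; have [Hq [sq hq]] := IH q q0 qk.
exact: haar_merge hp hq.
Qed.

(** * Thresholding in the Haar basis *)

Definition dotm (R : realType) (n1 n2 : nat) (A B : 'M[R]_(n1, n2)) : R :=
  \sum_i \sum_j A i j * B i j.

Lemma dotmE (R : realType) (n1 n2 : nat) (A B : 'M[R]_(n1, n2)) :
  dotm A B = \tr (A^T *m B).
Proof.
rewrite /dotm /mxtrace exchange_big; apply: eq_bigr => j _; rewrite mxE.
by apply: eq_bigr => i _; rewrite mxE.
Qed.

Lemma frob_dotm (R : realType) (n1 n2 : nat) (A : 'M[R]_(n1, n2)) :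
  frob A ^+ 2 = dotm A A.
Proof.
rewrite frob_sqr; apply: eq_bigr => i _; apply: eq_bigr => j _.
by rewrite expr2.
Qed.

(** Parseval's identity: [H1 *m A *m H2^T] is the matrix of coefficients of [A] in the tensor
    basis. *)
Lemma dotm_ortho (R : realType) (n1 n2 : nat) (H1 : 'M[R]_n1) (H2 : 'M[R]_n2)
    (A B : 'M[R]_(n1, n2)) :
  H1 *m H1^T = 1%:M -> H2 *m H2^T = 1%:M ->
  dotm (H1 *m A *m H2^T) (H1 *m B *m H2^T) = dotm A B.
Proof.
move=> /mulmx1C o1 /mulmx1C o2.
rewrite !dotmE !trmx_mul trmxK !mulmxA -(mulmxA _ H1^T) o1 mulmx1.
by rewrite mxtrace_mulC !mulmxA o2 mul1mx.
Qed.

Lemma mulmx_bil (R : realType) (n1 n2 : nat) (H1 : 'M[R]_n1) (H2 : 'M[R]_n2)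
    (A : 'M[R]_(n1, n2)) i j :
  (H1 *m A *m H2^T) i j = bil (H1 i) A (H2 j).
Proof.
rewrite mxE /bil exchange_big; apply: eq_bigr => l _; rewrite !mxE mulr_suml.
by apply: eq_bigr.
Qed.

Lemma bilB (R : realType) (n1 n2 : nat) u v (A B : 'M[R]_(n1, n2)) :
  bil u (A - B) v = bil u A v - bil u B v.
Proof.
rewrite /bil -sumrB; apply: eq_bigr => i _; rewrite -sumrB; apply: eq_bigr => j _.
rewrite !mxE; ring.
Qed.

Lemma bil_sum (R : realType) (n1 n2 : nat) (I J : finType) (P : pred I) (Q : pred J)
    (u : I -> 'I_n1 -> R) (v : J -> 'I_n2 -> R) (A : 'M[R]_(n1, n2)) :
  \sum_(i | P i) \sum_(j | Q j) bil (u i) A (v j)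
  = bil (fun k => \sum_(i | P i) u i k) A (fun l => \sum_(j | Q j) v j l).
Proof.
rewrite /bil.
under eq_bigr do rewrite exchange_big; rewrite exchange_big; apply: eq_bigr => k _.
under eq_bigr do rewrite exchange_big; rewrite exchange_big; apply: eq_bigr => l _.
rewrite mulr_suml mulr_suml; apply: eq_bigr => i _; rewrite mulr_sumr.
by apply: eq_bigr.
Qed.

(** The tensor difference splits as [(u' - u)] against [v'] plus [u] against [(v' - v)], two
    products of dual vectors. *)
Lemma bil_le (R : realType) (n1 n2 : nat) u u' v v' (A : 'M[R]_(n1, n2)) :
  anti_monge A -> dual u -> dual v' ->
  dual (fun i => u' i - u i) -> dual (fun i => v' i - v i) ->
  bil u A v <= bil u' A v'.
Proof.
move=> mA du dv' du' dv.
have -> : bil u' A v' = bil u A v + (bil (fun i => u' i - u i) A v' + bil u A (fun i => v' i - v i)).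
  rewrite /bil -!big_split; apply: eq_bigr => i _; rewrite -!big_split; apply: eq_bigr => j _.
  rewrite /=; ring.
by rewrite lerDl addr_ge0 ?bil_ge0.
Qed.

(** Lagrange's identity: the double sum of squares below is twice the gap. *)
Lemma sumr_CauchySchwarz (R : realType) (I : finType) (a b : I -> R) :
  (\sum_i a i * b i) ^+ 2 <= (\sum_i a i ^+ 2) * (\sum_i b i ^+ 2).
Proof.
have : 0 <= \sum_i \sum_j (a i * b j - a j * b i) ^+ 2.
  by apply: sumr_ge0 => i _; apply: sumr_ge0 => j _; exact: sqr_ge0.
have -> : \sum_i \sum_j (a i * b j - a j * b i) ^+ 2
   = ((\sum_i a i ^+ 2) * (\sum_i b i ^+ 2) - (\sum_i a i * b i) ^+ 2) *+ 2.
  pose X := \sum_i \sum_j a i ^+ 2 * b j ^+ 2; pose Y := \sum_i \sum_j a i * b i * (a j * b j).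
  have EX : (\sum_i a i ^+ 2) * (\sum_i b i ^+ 2) = X.
    by rewrite mulr_suml; apply: eq_bigr => i _; rewrite mulr_sumr.
  have EY : (\sum_i a i * b i) ^+ 2 = Y.
    by rewrite expr2 mulr_suml; apply: eq_bigr => i _; rewrite mulr_sumr.
  have EX' : \sum_i \sum_j a j ^+ 2 * b i ^+ 2 = X by rewrite exchange_big.
  rewrite EX EY mulr2n -{2}EX' /X /Y -!sumrB -big_split; apply: eq_bigr => i _.
  rewrite -!sumrB -big_split; apply: eq_bigr => j _ /=; ring.
by rewrite pmulrn_lge0 // subr_ge0.
Qed.

Lemma bil_frob (R : realType) (n1 n2 : nat) u v (A : 'M[R]_(n1, n2)) :
  bil u A v ^+ 2 <= (\sum_i u i ^+ 2) * (\sum_j v j ^+ 2) * frob A ^+ 2.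
Proof.
rewrite frob_sqr /bil !pair_bigA /=.
have -> : \sum_p u p.1 * A p.1 p.2 * v p.2 = \sum_p (u p.1 * v p.2) * A p.1 p.2.
  by apply: eq_bigr => p _; rewrite mulrAC.
apply: le_trans (sumr_CauchySchwarz _ _) _.
rewrite ler_wpM2r //; first by apply: sumr_ge0 => p _; exact: sqr_ge0.
rewrite mulr_suml; under [leRHS]eq_bigr do rewrite mulr_sumr.
by rewrite pair_bigA le_eqVlt; apply/orP; left; apply/eqP/eq_bigr => p _ /=; rewrite exprMn.
Qed.

(** Nonnegative entries give [(L - U) ^ 2 <= L ^ 2 + U ^ 2], and the factor [2 ^ a] cancels the
    spread of each probability vector, leaving 2 + 2. *)
Lemma envelope_sqr (R : realType) (n a : nat) (L U : 'I_n -> R) :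
  prob_vec L -> prob_vec U -> \sum_i L i ^+ 2 <= 2 / 2 ^+ a -> \sum_i U i ^+ 2 <= 2 / 2 ^+ a ->
  \sum_i (Num.sqrt (2 ^+ a) * (L i - U i)) ^+ 2 <= 4.
Proof.
move=> [L0 _] [U0 _] sL sU.
have a0 : 0 < 2 ^+ a :> R by rewrite exprn_gt0.
apply: (@le_trans _ _ (2 ^+ a * (\sum_i L i ^+ 2 + \sum_i U i ^+ 2))).
  rewrite -big_split mulr_sumr; apply: ler_sum => i _ /=.
  rewrite exprMn sqr_sqrtr ?(ltW a0) // ler_wpM2l ?(ltW a0) //.
  by have := L0 i; have := U0 i; nra.
have : 2 / 2 ^+ a * 2 ^+ a = 2 :> R by rewrite divfK // gt_eqF.
move: a0 sL sU; set x := \sum_i _; set y := \sum_i _; set z := 2 ^+ a; set w := 2 / z.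
by nra.
Qed.

(** The point mass at the first index lies left of [L], and [U] lies left of the point mass at the
    last index, so both differences are dual. This is how the corner variation dominates every
    envelope. *)
Lemma envelope_corner (R : realType) (n : nat) (L U : 'I_n.+1 -> R) :
  prob_vec L -> prob_vec U ->
  dual (fun i => ((i == ord0)%:R - (i == ord_max)%:R) - (L i - U i)).
Proof.
move=> pL pU.
have pd (k : 'I_n.+1) : prob_vec (fun i => (i == k)%:R : R).
  split=> [i|]; first by rewrite ler0n.
  by rewrite (bigD1 k) //= eqxx big1 ?addr0 // => i /negPf ->.
have -> : (fun i => ((i == ord0)%:R - (i == ord_max)%:R) - (L i - U i))
   = fun i => ((i == ord0)%:R - L i) + (U i - (i == ord_max)%:R).
  apply/funext => i; ring.
apply: dualD; apply: prob_vec_sub_dual => // i k.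
  by rewrite pnatr_eq0 eqb0 negbK => /eqP ->.
by move=> _; rewrite pnatr_eq0 eqb0 negbK => /eqP ->; rewrite -ltnS ltn_ord.
Qed.

Lemma bil_corner (R : realType) (m1 m2 : nat) (A : 'M[R]_(m1.+1, m2.+1)) :
  bil (fun i => (i == ord0)%:R - (i == ord_max)%:R) A
      (fun j => (j == ord0)%:R - (j == ord_max)%:R) = corner_variation A.
Proof.
have delta n (f : 'I_n.+1 -> R) :
    \sum_i ((i == ord0)%:R - (i == ord_max)%:R) * f i = f ord0 - f ord_max.
  under eq_bigr do rewrite mulrBl !mulr_natl !mulrb.
  by rewrite sumrB -!big_mkcond !big_pred1_eq.
rewrite /bil.
under eq_bigr => i _ do (under eq_bigr => j _ do rewrite -mulrA (mulrC (A i j)); rewrite -mulr_sumr delta).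
rewrite delta /corner_variation; ring.
Qed.

(** For [0 <= tau], the absolute value of [z] soft-thresholded at [tau]. *)
Definition excess (R : realType) (tau z : R) : R := Num.max (`|z| - tau) 0.

(** Bound [|z|] by [tau + excess tau z] and apply the arithmetic-geometric inequality to
    [excess tau z * |c|]. *)
Lemma mul_le_excess (R : realType) (tau z c : R) : 0 <= tau ->
  z * c <= tau * `|c| + excess tau z ^+ 2 + c ^+ 2 / 4.
Proof.
move=> t0; apply: le_trans (ler_norm _) _; rewrite normrM -(real_normK (num_real c)).
have := normr_ge0 z; have := normr_ge0 c; rewrite /excess.
set x := `|z|; set y := `|c| => y0 x0.
case: (leP (x - tau) 0) => h; last by have := sqr_ge0 (x - tau - y / 2); nra.
have := mulr_ge0 y0 (_ : 0 <= tau - x); rewrite expr0n /=; have := sqr_ge0 y; nra.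
Qed.

Lemma sum_ord_eq (R : realType) (k x : nat) (F : nat -> R) :
  \sum_(a < k | x == a) F a = if (x < k)%N then F x else 0.
Proof. by under eq_bigl do rewrite eq_sym; exact: big_ord1_eq. Qed.

(** Non-constant coefficients of [t] and [theta] are nonnegative, so absolute values cost only a
    sum, and each sum is at most the product with the envelopes [W1], [W2]. For [t] this product is
    the one for [theta] plus a Cauchy-Schwarz error in [t - theta], which explains the factor 2 on
    the variation of [theta]. *)
Lemma scale_sum (R : realType) (m1 m2 k1 k2 : nat) (H1 : 'M[R]_m1.+1) sc1 (H2 : 'M[R]_m2.+1) sc2
    (theta t : 'M[R]_(m1.+1, m2.+1)) (a b : nat) :
  haar_system k1 H1 sc1 -> haar_system k2 H2 sc2 -> anti_monge theta -> anti_monge t ->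
  (a < k1)%N -> (b < k2)%N ->
  \sum_(i | sc1 i == a) \sum_(j | sc2 j == b) `|bil (H1 i) (t - theta) (H2 j)|
  <= 4 * frob (t - theta) + 2 * corner_variation theta * (Num.sqrt (2 ^+ a) * Num.sqrt (2 ^+ b)).
Proof.
move=> hs1 hs2 mth mt ak bk.
have d1 i : sc1 i == a -> dual (H1 i) by move=> /eqP ia; apply: (haar_dual hs1); rewrite ia.
have d2 j : sc2 j == b -> dual (H2 j) by move=> /eqP jb; apply: (haar_dual hs2); rewrite jb.
have [L1 [U1 [pL1 pU1 sL1 sU1 e1]]] := haar_envelope hs1 ak.
have [L2 [U2 [pL2 pU2 sL2 sU2 e2]]] := haar_envelope hs2 bk.
pose S1 := fun k => \sum_(i | sc1 i == a) H1 i k.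
pose S2 := fun k => \sum_(j | sc2 j == b) H2 j k.
pose W1 := fun i => Num.sqrt (2 ^+ a) * (L1 i - U1 i).
pose W2 := fun i => Num.sqrt (2 ^+ b) * (L2 i - U2 i).
have dS1 : dual S1 by exact: dual_sum.
have dS2 : dual S2 by exact: dual_sum.
have dW1 : dual W1.
  have -> : W1 = fun i => (W1 i - S1 i) + S1 i by apply/funext => i; rewrite subrK.
  exact: dualD.
have dW2 : dual W2.
  have -> : W2 = fun i => (W2 i - S2 i) + S2 i by apply/funext => i; rewrite subrK.
  exact: dualD.
have envle A : anti_monge A -> \sum_(i | sc1 i == a) \sum_(j | sc2 j == b) bil (H1 i) A (H2 j) <= bil W1 A W2.
  by move=> mA; rewrite bil_sum; exact: bil_le.
have corner : bil W1 theta W2 <= corner_variation theta * (Num.sqrt (2 ^+ a) * Num.sqrt (2 ^+ b)).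
  rewrite -bil_corner.
  set E1 := fun i => _; set E2 := fun j => _.
  have -> : bil E1 theta E2 * (Num.sqrt (2 ^+ a) * Num.sqrt (2 ^+ b))
     = bil (fun i => Num.sqrt (2 ^+ a) * E1 i) theta (fun j => Num.sqrt (2 ^+ b) * E2 j).
    rewrite /bil mulr_suml; apply: eq_bigr => i _; rewrite mulr_suml; apply: eq_bigr => j _; ring.
  have dW n c (L U : 'I_n.+1 -> R) : prob_vec L -> prob_vec U -> 0 <= c ->
     dual (fun i => c * ((i == ord0)%:R - (i == ord_max)%:R) - c * (L i - U i)).
    move=> pL pU c0.
    have -> : (fun i => c * ((i == ord0)%:R - (i == ord_max)%:R) - c * (L i - U i))
      = fun i => c * (((i == ord0)%:R - (i == ord_max)%:R) - (L i - U i)).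
      by apply/funext => i; rewrite [RHS]mulrBr.
    by apply: dualZ => //; exact: envelope_corner.
  apply: bil_le => //; [|apply: dW => //; exact: sqrtr_ge0..].
  have -> : (fun j => Num.sqrt (2 ^+ b) * E2 j) = fun j => (Num.sqrt (2 ^+ b) * E2 j - W2 j) + W2 j.
    by apply/funext => j; rewrite subrK.
  by apply: dualD => //; apply: dW => //; exact: sqrtr_ge0.
(* Each envelope has squared norm at most 4, so Cauchy-Schwarz gives the factor
   [Num.sqrt (4 * 4)]. *)
have diff : bil W1 (t - theta) W2 <= 4 * frob (t - theta).
  have f0 : 0 <= frob (t - theta) by exact: sqrtr_ge0.
  apply: le_trans (ler_norm _) _; rewrite -(ler_pXn2r (n := 2)) ?nnegrE ?mulr_ge0 //.
  rewrite real_normK ?num_real //; apply: le_trans (bil_frob _ _ _) _.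
  rewrite exprMn ler_wpM2r ?sqr_ge0 // (expr2 4).
  apply: ler_pM; rewrite ?envelope_sqr //; by apply: sumr_ge0 => i _; exact: sqr_ge0.
apply: (@le_trans _ _ (bil W1 t W2 + bil W1 theta W2)).
  apply: le_trans (lerD (envle t mt) (envle theta mth)).
  rewrite -big_split; apply: ler_sum => i ia; rewrite -big_split; apply: ler_sum => j jb /=.
  rewrite bilB; apply: le_trans (ler_normB _ _) _.
  by rewrite !ger0_norm ?lexx //; apply: bil_ge0 => //; [apply: d1|apply: d2|apply: d1|apply: d2].
move: diff; rewrite bilB; move: corner; lra.
Qed.

(** By Parseval [dotm e h] is a sum over coefficients, to which [mul_le_excess] applies termwise;
    the terms linear in the coefficients of [h] are regrouped by scale for [scale_sum]. Coefficients
    against a constant vector have threshold 0 and stay entirely in the excess sum. *)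
Lemma haar_bound (R : realType) (m1 m2 k1 k2 : nat) (H1 : 'M[R]_m1.+1) sc1 (H2 : 'M[R]_m2.+1) sc2
    (tau : nat -> nat -> R) (theta t e : 'M[R]_(m1.+1, m2.+1)) :
  haar_system k1 H1 sc1 -> haar_system k2 H2 sc2 -> anti_monge theta -> anti_monge t ->
  (forall a b, 0 <= tau a b) -> frob (t - theta) ^+ 2 <= dotm e (t - theta) ->
  frob (t - theta) ^+ 2 <= 32 * (\sum_(a < k1) \sum_(b < k2) tau a b) ^+ 2
    + 4 * corner_variation theta
        * (\sum_(a < k1) \sum_(b < k2) tau a b * (Num.sqrt (2 ^+ a) * Num.sqrt (2 ^+ b)))
    + 2 * \sum_i \sum_j excess (if (sc1 i < k1)%N && (sc2 j < k2)%N then tau (sc1 i) (sc2 j) else 0)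
        ((H1 *m e *m H2^T) i j) ^+ 2.
Proof.
move=> hs1 hs2 mth mt tau0 basic.
set h := t - theta; set Th := \sum_(a < k1) _; set La := \sum_(a < k1) _; set F := \sum_i \sum_j _.
set V := corner_variation theta.
pose thr i j := if (sc1 i < k1)%N && (sc2 j < k2)%N then tau (sc1 i) (sc2 j) else 0.
have thr0 i j : 0 <= thr i j by rewrite /thr; case: ifP.
have split_le : dotm e h <= \sum_i \sum_j thr i j * `|bil (H1 i) h (H2 j)| + F + frob h ^+ 2 / 4.
  rewrite frob_dotm -(dotm_ortho e h (haar_ortho hs1) (haar_ortho hs2)).
  rewrite -(dotm_ortho h h (haar_ortho hs1) (haar_ortho hs2)) /dotm mulr_suml -!big_split.
  apply: ler_sum => i _; rewrite mulr_suml -!big_split; apply: ler_sum => j _ /=.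
  by rewrite -(mulmx_bil H1 H2) -expr2; exact: mul_le_excess.
have group : \sum_i \sum_j thr i j * `|bil (H1 i) h (H2 j)| <= 4 * frob h * Th + 2 * V * La.
  have -> : \sum_i \sum_j thr i j * `|bil (H1 i) h (H2 j)|
     = \sum_(a < k1) \sum_(b < k2) \sum_(i | sc1 i == a) \sum_(j | sc2 j == b)
         tau a b * `|bil (H1 i) h (H2 j)|.
    pose G a b i j := if (sc1 i == a) && (sc2 j == b) then tau a b * `|bil (H1 i) h (H2 j)| else 0.
    transitivity (\sum_(a < k1) \sum_(b < k2) \sum_i \sum_j G a b i j); last first.
      apply: eq_bigr => a _; apply: eq_bigr => b _; rewrite [RHS]big_mkcond; apply: eq_bigr => i _.
      rewrite /G; case: (_ == _) => /=; last by rewrite big1.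
      by rewrite [RHS]big_mkcond.
    under [RHS]eq_bigr do rewrite exchange_big; rewrite [RHS]exchange_big; apply: eq_bigr => i _ /=.
    under [RHS]eq_bigr do rewrite exchange_big; rewrite [RHS]exchange_big; apply: eq_bigr => j _ /=.
    have -> : thr i j * `|bil (H1 i) h (H2 j)|
        = \sum_(a < k1 | sc1 i == a) \sum_(b < k2 | sc2 j == b) tau a b * `|bil (H1 i) h (H2 j)|.
      under eq_bigr => a _ do rewrite (sum_ord_eq k2 (sc2 j) (fun b => tau a b * `|bil (H1 i) h (H2 j)|)).
      rewrite (sum_ord_eq k1 (sc1 i) (fun a => if (sc2 j < k2)%N then tau a (sc2 j) * `|bil (H1 i) h (H2 j)| else 0)).
      by rewrite /thr; case: (ltnP (sc1 i)) => _; case: (ltnP (sc2 j)) => _; rewrite /= ?mul0r.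
    rewrite big_mkcond; apply: eq_bigr => a _; rewrite /G; case: (_ == _) => /=; last by rewrite big1.
    by rewrite big_mkcond.
  rewrite /Th /La !mulr_sumr -big_split; apply: ler_sum => a _.
  rewrite !mulr_sumr -big_split; apply: ler_sum => b _ /=.
  under eq_bigr do rewrite -mulr_sumr; rewrite -mulr_sumr.
  have := scale_sum hs1 hs2 mth mt (ltn_ord a) (ltn_ord b); rewrite -/h -/V => sc.
  apply: le_trans (ler_wpM2l (tau0 _ _) sc) _; lra.
(* This square gives [4 * frob h * Th <= frob h ^ 2 / 4 + 16 * Th ^ 2]. With the quarter from
   [split_le], half of [frob h ^ 2] is absorbed and the remaining terms double. *)
have := sqr_ge0 (frob h - 8 * Th); move: basic split_le group; rewrite -/h; nra.
Qed.

(** * Exponential moments of the noise *)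

Lemma expR1_bounds (R : realType) : 2 <= expR (1 : R) <= 4.
Proof.
apply/andP; split; first by have := expR_ge1Dx (1 : R); lra.
have h : 2^-1 <= expR (- 2^-1) :> R by have := expR_ge1Dx (- 2^-1 : R); lra.
have -> : expR (1 : R) = expR (- (- 2^-1 + - 2^-1)) by congr expR; field.
rewrite expRN expRD -[leRHS]invrK lef_pV2 ?posrE ?mulr_gt0 ?expR_gt0 // ?invr_gt0 //.
have -> : 4^-1 = 2^-1 * 2^-1 :> R by field.
by apply: ler_pM.
Qed.

Lemma expRN_natr_le (R : realType) (k : nat) : expR (- (k%:R ^+ 2 / 2)) <= expR 1 / 2 ^+ k :> R.
Proof.
apply: (@le_trans _ _ (expR (1 - k%:R))).
  by rewrite ler_expR; have := sqr_ge0 (k%:R - 1 : R); nra.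
rewrite expRD expRN ler_wpM2l ?expR_ge0 // lef_pV2 ?posrE ?expR_gt0 ?exprn_gt0 //.
rewrite -[k%:R]mulr1 expRM_natl; apply: lerXn2r; rewrite ?nnegrE ?expR_ge0 //.
by case/andP: (expR1_bounds R).
Qed.

(* [k] is the integer part of [|z| / 2], which nearly maximizes [k |z| - k ^ 2]. *)
Lemma expR_sqr_le (R : realType) (z : R) : exists k : nat,
  expR (z ^+ 2 / 4) <= expR 1 * expR (- (k%:R ^+ 2)) * (expR (k%:R * z) + expR (- k%:R * z)).
Proof.
have z0 : 0 <= `|z| / 2 by rewrite divr_ge0.
exists (Num.truncn (`|z| / 2)); have /andP[] := truncn_itv z0.
set k := Num.truncn _; rewrite -(natr1 k) => kl ku.
apply: (@le_trans _ _ (expR 1 * expR (- (k%:R ^+ 2)) * expR (k%:R * `|z|))).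
  rewrite -!expRD ler_expR -(real_normK (num_real z)); nra.
rewrite ler_wpM2l ?mulr_ge0 ?expR_ge0 //.
have [h|h] := ger0P z; first by rewrite lerDl expR_ge0.
by rewrite mulrN -mulNr lerDr expR_ge0.
Qed.

(** The integer [k] of [expR_sqr_le] depends on the point; summing over all [k] removes this
    dependence. Integrated termwise, [expR (- k ^ 2)] loses only half its exponent to the moment
    bound and stays summable. [X] carries the other factors of the product. *)
Lemma exp_sqr_step d (T : measurableType d) (R : realType) (P : probability T R)
    (X Z : T -> R) (q M : R) :
  measurable_fun setT X -> measurable_fun setT Z -> (forall w, 0 <= X w) -> 0 <= q -> 0 <= M ->
  (forall x : R, (\int[P]_w (X w * expR (x * Z w))%:E <= (M * expR (x ^+ 2 / 2))%:E)%E) ->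
  (\int[P]_w (X w * (1 + q * expR (Z w ^+ 2 / 4)))%:E <= (M * (1 + 64 * q))%:E)%E.
Proof.
move=> mX mZ X0 q0 M0 hX.
have mE (x : R) : measurable_fun setT (fun w => X w * expR (x * Z w)).
  by apply: measurable_funM => //; apply: measurableT_comp => //; apply: measurable_funM.
have E0 x w : 0 <= X w * expR (x * Z w) by rewrite mulr_ge0 ?expR_ge0.
pose c (k : nat) : R := q * (expR 1 * expR (- (k%:R ^+ 2))).
have c0 k : 0 <= c k by rewrite /c !mulr_ge0 ?expR_ge0.
pose f (k : nat) w := ((c k)%:E * ((X w * expR (k%:R * Z w))%:E + (X w * expR (- k%:R * Z w))%:E))%E.
have f0 k w : (0 <= f k w)%E by rewrite /f mule_ge0 ?adde_ge0 ?lee_fin.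
have mf k : measurable_fun setT (f k).
  apply: measurable_funeM; apply: emeasurable_funD; exact/measurable_EFinP.
apply: (@le_trans _ _ (\int[P]_w ((X w)%:E + \sum_(k <oo) f k w))%E).
  apply: ge0_le_integral => //.
  - by move=> w _; rewrite lee_fin mulr_ge0 // addr_ge0 // mulr_ge0 ?expR_ge0.
  - apply/measurable_EFinP; apply: measurable_funM => //; apply: measurable_funD => //.
    apply: measurable_funM => //; apply: measurableT_comp => //; apply: measurable_funM => //.
    exact: measurable_funX.
  - apply: emeasurable_funD; first exact/measurable_EFinP.
    by apply: ge0_emeasurable_sum => //.
  move=> w _; have [k kle] := expR_sqr_le (Z w).
  rewrite mulrDr mulr1 EFinD leeD2l //.
  apply: (@le_trans _ _ (\sum_(0 <= i < k.+1) f i w)%E); last by apply: nneseries_lim_ge => n _ _.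
  rewrite big_nat_recr //=; apply: (@le_trans _ _ (f k w)); last by rewrite leeDr // sume_ge0.
  rewrite /f -EFinD -EFinM lee_fin /c.
  have := ler_wpM2l (mulr_ge0 q0 (X0 w)) kle; nra.
rewrite ge0_integralD //; last 4 first.
- by move=> w _; rewrite lee_fin.
- exact/measurable_EFinP.
- by move=> w _; exact: nneseries_ge0.
- by apply: ge0_emeasurable_sum => //.
rewrite integral_nneseries // mulrDr mulr1 EFinD; apply: leeD.
  have -> : (\int[P]_w (X w)%:E = \int[P]_w (X w * expR (0 * Z w))%:E)%E.
    by apply: eq_integral => w _; rewrite mul0r expR0 mulr1.
  by apply: le_trans (hX 0) _; rewrite expr0n mul0r expR0 mulr1.
(* The k-th integral gets the share [M * (64 * q) / 2 ^ k.+1]: it is at most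
   [2 * q * M * expR 1 ^ 2 / 2 ^ k], and [expR 1 ^ 2 <= 16]. *)
apply: le_trans (epsilon_trick0 xpredT _); last by rewrite !mulr_ge0.
apply: lee_nneseries => [k _ _|k _]; first exact: integral_ge0.
rewrite /f ge0_integralZl_EFin //; last 2 first.
- by move=> w _; rewrite adde_ge0 ?lee_fin.
- by apply: emeasurable_funD; exact/measurable_EFinP.
rewrite ge0_integralD //; try by [move=> w _; rewrite lee_fin|exact/measurable_EFinP].
apply: (@le_trans _ _ ((c k)%:E * ((M * expR (k%:R ^+ 2 / 2))%:E + (M * expR (k%:R ^+ 2 / 2))%:E))%E).
  rewrite lee_wpmul2l ?lee_fin // leeD ?hX //.
  by have := hX (- k%:R); rewrite sqrrN.
rewrite -EFinD -EFinM lee_fin /c.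
have -> : q * (expR 1 * expR (- k%:R ^+ 2)) * (M * expR (k%:R ^+ 2 / 2) + M * expR (k%:R ^+ 2 / 2))
  = 2 * q * M * expR 1 * expR (- (k%:R ^+ 2 / 2)).
  have -> : expR (- (k%:R ^+ 2 / 2)) = expR (- k%:R ^+ 2) * expR (k%:R ^+ 2 / 2) :> R.
    by rewrite -expRD; congr expR; field.
  ring.
have -> : (2 ^ k.+1)%:R = 2 * 2 ^+ k :> R by rewrite natrX exprS.
rewrite invfM.
apply: (@le_trans _ _ (2 * q * M * expR 1 * (expR 1 / 2 ^+ k))).
  by rewrite ler_wpM2l ?expRN_natr_le // !mulr_ge0 ?expR_ge0.
have [e2 e4] := andP (expR1_bounds R).
have k0 : 0 <= (2 ^+ k)^-1 :> R by rewrite invr_ge0 exprn_ge0.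
have qM : 0 <= q * M * (2 ^+ k)^-1 by rewrite !mulr_ge0.
have : expR 1 * expR 1 <= 16 :> R by nra.
move/(ler_wpM2l qM); nra.
Qed.

(** Induction on the list [s] of indices whose factor is present. The statement carries an
    exponential tilt [v] vanishing on [s]; when [j] joins the list, the tilt in direction [j] is the
    free parameter [x] of [exp_sqr_step]. *)
Lemma exp_quadratic d (T : measurableType d) (R : realType) (P : probability T R)
    (J : finType) (Z : J -> T -> R) (q : J -> R) :
  (forall j, measurable_fun setT (Z j)) -> (forall j, 0 <= q j) ->
  (forall v : J -> R,
     (\int[P]_w (expR (\sum_j v j * Z j w))%:E <= (expR ((\sum_j v j ^+ 2) / 2))%:E)%E) ->
  (\int[P]_w (\prod_j (1 + q j * expR (Z j w ^+ 2 / 4)))%:E <= (\prod_j (1 + 64 * q j))%:E)%E.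
Proof.
move=> mZ q0 mgf.
pose g j w := 1 + q j * expR (Z j w ^+ 2 / 4).
have g0 j w : 0 <= g j w by rewrite addr_ge0 // mulr_ge0 ?expR_ge0.
have mg j : measurable_fun setT (g j).
  apply: measurable_funD => //; apply: measurable_funM => //; apply: measurableT_comp => //.
  by apply: measurable_funM => //; exact: measurable_funX.
suff H (s : seq J) : uniq s -> forall v : J -> R, (forall j, j \in s -> v j = 0) ->
    (\int[P]_w (expR (\sum_j v j * Z j w) * \prod_(j <- s) g j w)%:E
      <= (expR ((\sum_j v j ^+ 2) / 2) * \prod_(j <- s) (1 + 64 * q j))%:E)%E.
  have := H (index_enum J) (index_enum_uniq J) (fun=> 0) (fun _ _ => erefl).
  have -> : \sum_(j : J) 0 ^+ 2 = 0 :> R by apply: big1 => j _; rewrite expr0n.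
  rewrite mul0r expR0 mul1r; apply: le_trans.
  rewrite le_eqVlt; apply/orP; left; apply/eqP; apply: eq_integral => w _.
  by rewrite [X in expR X * _]big1 ?expR0 ?mul1r // => j _; rewrite mul0r.
elim: s => [_|j s IH /andP[js us]] v v0.
  by under eq_integral do rewrite big_nil mulr1; rewrite big_nil mulr1.
pose X w := expR (\sum_j v j * Z j w) * \prod_(j <- s) g j w.
have mX : measurable_fun setT X.
  apply: measurable_funM; last by apply: measurable_prod.
  apply: measurableT_comp => //; apply: measurable_sum => i; exact: measurable_funM.
have X0 w : 0 <= X w by rewrite mulr_ge0 ?expR_ge0 ?prodr_ge0.
under eq_integral => w _ do rewrite big_cons mulrCA mulrC -/(X w).
rewrite big_cons mulrCA mulrC; apply: exp_sqr_step => //.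
  by rewrite mulr_ge0 ?expR_ge0 // prodr_ge0 // => i _; rewrite addr_ge0 ?mulr_ge0.
move=> x; pose v' i := if i == j then x else v i.
have v'0 i : i \in s -> v' i = 0.
  by move=> is_; rewrite /v'; case: eqP => [ij|_]; [rewrite -ij is_ in js | rewrite v0 // inE is_ orbT].
have vj : v j = 0 by rewrite v0 // inE eqxx.
have := IH us v' v'0.
have -> : (\sum_i v' i ^+ 2) / 2 = (\sum_i v i ^+ 2) / 2 + x ^+ 2 / 2.
  rewrite (bigD1 j) //= [in RHS](bigD1 j) //= /v' eqxx vj.
  rewrite (eq_bigr (fun i => v i ^+ 2)) ; last by move=> i /negPf ->.
  by field.
rewrite expRD mulrAC; apply: le_trans.
rewrite le_eqVlt; apply/orP; left; apply/eqP; apply: eq_integral => w _.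
congr EFin; rewrite /X mulrAC -expRD; congr (expR _ * _).
rewrite (bigD1 j) //= [in RHS](bigD1 j) //= /v' eqxx vj mul0r add0r addrC; congr (_ + _).
by apply: eq_bigr => i /negPf ->.
Qed.

(** Markov's inequality for [expR Y] at level [expR (B + x)] gives the tail; integrating
    [1 + (Y - B) <= expR (Y - B)] gives the mean. *)
Lemma exp_moment d (T : measurableType d) (R : realType) (P : probability T R)
    (X Y : T -> R) (c D B x r : R) :
  measurable_fun setT X -> measurable_fun setT Y ->
  (forall w, 0 <= X w) -> (forall w, 0 <= Y w) -> 0 < c -> 0 <= D -> 0 <= B -> 0 <= x ->
  (forall w, X w <= c * (D + Y w)) -> c * (D + B + x) <= r ->
  (\int[P]_w (expR (Y w))%:E <= (expR B)%:E)%E ->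
  ((1 - expR (- x))%:E <= P [set w | (X w <= r)%R])%E /\ ('E_P[X] <= r%:E)%E.
Proof.
move=> mX mY X0 Y0 c0 D0 B0 x0 XY cr EY.
have mEY : measurable_fun setT (fun w => (expR (Y w))%:E).
  by apply/measurable_EFinP; apply: measurableT_comp.
split.
  pose A := [set w | (expR (B + x))%:E <= `|(expR (Y w))%:E|]%E.
  have mA : measurable A.
    rewrite -[A]setTI; apply: emeasurable_fun_c_infty => //; exact: measurableT_comp.
  have PA : (P A <= (expR (- x))%:E)%E.
    have : ((expR (B + x))%:E * P A <= (expR B)%:E)%E.
      have := le_integral_abse P measurableT mEY (expR_gt0 (B + x)); rewrite setTI => /le_trans; apply.
      by under eq_integral do rewrite gee0_abs ?lee_fin ?expR_ge0 //.
    rewrite -(fineK (fin_num_measure P A mA)) -EFinM !lee_fin.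
    rewrite expRD -mulrA -[leRHS]mulr1 ler_pM2l ?expR_gt0 // => h.
    by rewrite expRN -[leRHS]mul1r ler_pdivlMr ?expR_gt0 // mulrC.
  apply: (@le_trans _ _ (P (~` A))).
    by rewrite probability_setC // EFinB leeB.
  apply: le_measure; rewrite ?inE; first exact: measurableC.
    rewrite -[X in measurable X]setTI; exact: measurable_fun_le.
  move=> w /= /negP; rewrite -ltNge gee0_abs ?lee_fin ?expR_ge0 // lte_fin ltr_expR => h.
  by apply: le_trans (XY w) _; apply: le_trans cr; rewrite ler_pM2l // -addrA lerD2l ltW.
have cst_int (a : R) : (\int[P]_w a%:E = a%:E)%E.
  rewrite integral_cst // -[RHS]mule1; congr (_ * _)%E; exact: probability_setT.
have EY1 : (\int[P]_w (Y w)%:E <= B%:E)%E.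
  (* Moving [B] to the right makes both integrands nonnegative, so the integrals split. *)
  have : (\int[P]_w ((Y w)%:E + 1%:E) <= \int[P]_w (B%:E + (expR (- B))%:E * (expR (Y w))%:E))%E.
    apply: ge0_le_integral => //.
    - by move=> w _; rewrite -EFinD lee_fin addr_ge0.
    - by apply: emeasurable_funD => //; exact/measurable_EFinP.
    - by apply: emeasurable_funD => //; exact: measurable_funeM.
    move=> w _; rewrite -EFinM -!EFinD lee_fin -expRD.
    have := expR_ge1Dx (- B + Y w); lra.
  rewrite !ge0_integralD //; last 3 first.
  - exact: measurable_funeM.
  - by move=> w _; rewrite lee_fin.
  - exact/measurable_EFinP.
  rewrite ge0_integralZl_EFin ?expR_ge0 //.
  rewrite !cst_int => h.
  have h2 : ((expR (- B))%:E * \int[P]_w (expR (Y w))%:E <= 1%:E)%E.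
    apply: le_trans (lee_wpmul2l _ EY) _; first by rewrite lee_fin expR_ge0.
    by rewrite -EFinM lee_fin -expRD addNr expR0.
  have := le_trans h (leeD2l B%:E h2).
  by rewrite leeD2rE.
apply: (@le_trans _ _ (c * (D + B))%:E); last first.
  by rewrite lee_fin; apply: le_trans cr; rewrite ler_pM2l // lerDl.
rewrite unlock; apply: (@le_trans _ _ (\int[P]_w (c%:E * (D%:E + (Y w)%:E)))%E).
  apply: ge0_le_integral => //.
  - by move=> w _; rewrite lee_fin.
  - exact/measurable_EFinP.
  - by apply: measurable_funeM; apply: emeasurable_funD => //; exact/measurable_EFinP.
  by move=> w _; rewrite -EFinD -EFinM lee_fin.
rewrite ge0_integralZl_EFin ?(ltW c0) //; last 2 first.
- by move=> w _; rewrite -EFinD lee_fin addr_ge0.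
- by apply: emeasurable_funD => //; exact/measurable_EFinP.
rewrite EFinM lee_wpmul2l ?lee_fin ?(ltW c0) // ge0_integralD //; last 2 first.
- by move=> w _; rewrite lee_fin.
- exact/measurable_EFinP.
by rewrite cst_int EFinD leeD2l.
Qed.

(** * The least-squares projection *)

Lemma dotm_le_frob (R : realType) (n1 n2 : nat) (A B : 'M[R]_(n1, n2)) :
  dotm A B <= frob A * frob B.
Proof.
apply: le_trans (ler_norm _) _.
rewrite -(ler_pXn2r (n := 2)) ?nnegrE ?mulr_ge0 ?sqrtr_ge0 //.
rewrite real_normK ?num_real // exprMn !frob_sqr /dotm !pair_bigA /=.
exact: sumr_CauchySchwarz.
Qed.

Lemma frobD (R : realType) (n1 n2 : nat) (A B : 'M[R]_(n1, n2)) :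
  frob (A + B) <= frob A + frob B.
Proof.
rewrite -(ler_pXn2r (n := 2)) ?nnegrE ?addr_ge0 ?sqrtr_ge0 //.
have -> : frob (A + B) ^+ 2 = frob A ^+ 2 + 2 * dotm A B + frob B ^+ 2.
  rewrite !frob_sqr /dotm mulr_sumr -!big_split; apply: eq_bigr => i _.
  rewrite mulr_sumr -!big_split; apply: eq_bigr => j _ /=; rewrite mxE; ring.
have := dotm_le_frob A B; nra.
Qed.

Lemma anti_monge_segment (R : realType) (n1 n2 : nat) (t u : 'M[R]_(n1, n2)) (l : R) :
  anti_monge t -> anti_monge u -> 0 <= l <= 1 -> anti_monge (t + l *: (u - t)).
Proof.
move=> mt mu /andP[l0 l1] i k j r ik jr; rewrite !mxE.
have := mt i k j r ik jr; have := mu i k j r ik jr; nra.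
Qed.

Lemma lsP (R : realType) (n1 n2 : nat) (y : 'M[R]_(n1, n2)) : is_least_squares y (ls y).
Proof. exact/ls_least_squares. Qed.

(** First-order optimality of the projection onto a convex set: the objective is compared along the
    segment from [ls y] to [u], which stays in the cone. *)
Lemma ls_variational (R : realType) (n1 n2 : nat) (y u : 'M[R]_(n1, n2)) :
  anti_monge u -> dotm (y - ls y) (u - ls y) <= 0.
Proof.
have [] := lsP y; set t := ls y => mt min mu.
set a := dotm _ _; set b := frob (u - t) ^+ 2.
have b0 : 0 <= b by exact: sqr_ge0.
rewrite leNgt; apply/negP => a0.
have key l : 0 < l <= 1 -> 2 * a <= l * b.
  move=> /andP[l0 l1].
  have := min _ (anti_monge_segment mt mu _); move=> /(_ l); rewrite l1 ltW // => /(_ isT).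
  have -> : frob (t + l *: (u - t) - y) ^+ 2 = frob (t - y) ^+ 2 - 2 * l * a + l ^+ 2 * b.
    rewrite /a /b !frob_sqr /dotm mulr_sumr mulr_sumr -sumrB -big_split; apply: eq_bigr => i _ /=.
    rewrite mulr_sumr mulr_sumr -sumrB -big_split; apply: eq_bigr => j _ /=; rewrite !mxE; ring.
  move=> h; rewrite -(ler_pM2l l0); nra.
have ab : 0 < a + b by rewrite ltr_pwDl.
(* At this [l] the bound becomes [2 * a * (a + b) <= a * b], impossible for positive [a]. *)
have := key (a / (a + b)); rewrite divr_gt0 // ler_pdivrMr // mul1r lerDl b0 => /(_ isT).
rewrite mulrAC ler_pdivlMr //; nra.
Qed.

(** The variational inequality at [theta]; comparing objective values alone would cost a factor
    2. *)
Lemma ls_basic (R : realType) (n1 n2 : nat) (theta e : 'M[R]_(n1, n2)) :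
  anti_monge theta ->
  frob (ls (theta + e) - theta) ^+ 2 <= dotm e (ls (theta + e) - theta).
Proof.
move=> /(ls_variational (theta + e)); set t := ls _.
have -> : dotm (theta + e - t) (theta - t) = frob (t - theta) ^+ 2 - dotm e (t - theta).
  rewrite frob_sqr /dotm -sumrB; apply: eq_bigr => i _; rewrite -sumrB; apply: eq_bigr => j _.
  rewrite !mxE; ring.
by rewrite subr_le0.
Qed.

(** Adding the variational inequalities of the two projections and using Cauchy-Schwarz makes [ls]
    1-Lipschitz, from which the measurability of the loss follows. *)
Lemma ls_contraction (R : realType) (n1 n2 : nat) (y z : 'M[R]_(n1, n2)) :
  frob (ls y - ls z) <= frob (y - z).
Proof.
have [my _] := lsP y; have [mz _] := lsP z.
have := ls_variational y mz; have := ls_variational z my; set s := ls y; set t := ls z => h1 h2.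
have : frob (s - t) ^+ 2 <= dotm (y - z) (s - t).
  have -> : dotm (y - z) (s - t)
     = frob (s - t) ^+ 2 - (dotm (z - t) (s - t) + dotm (y - s) (t - s)).
    rewrite frob_sqr /dotm -big_split -sumrB; apply: eq_bigr => i _.
    rewrite -big_split -sumrB; apply: eq_bigr => j _ /=; rewrite !mxE; ring.
  by lra.
move=> /le_trans /(_ (dotm_le_frob _ _)).
have : 0 <= frob (s - t) by exact: sqrtr_ge0.
rewrite le_eqVlt => /orP[/eqP <- _|f0]; first exact: sqrtr_ge0.
by rewrite expr2 ler_pM2r.
Qed.

(** * Measurability of the least-squares loss *)

Lemma frob_le_sup (R : realType) (n1 n2 : nat) (A : 'M[R]_(n1, n2)) (d : R) :
  0 < d -> (forall i j, `|A i j| <= d / (n1 * n2).+1%:R) -> frob A < d.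
Proof.
move=> d0 hA; set N := (n1 * n2)%N.
have N0 : 0 < N.+1%:R :> R by rewrite ltr0n.
rewrite -(ltr_pXn2r (n := 2)) ?nnegrE ?sqrtr_ge0 ?(ltW d0) // frob_sqr.
apply: (@le_lt_trans _ _ (\sum_(i < n1) \sum_(j < n2) (d / N.+1%:R) ^+ 2)).
  apply: ler_sum => i _; apply: ler_sum => j _; rewrite -(real_normK (num_real (A i j))).
  by apply: lerXn2r; rewrite ?nnegrE // divr_ge0 ?ltW.
rewrite !sumr_const !card_ord -mulrnA mulnC -/N -[ltLHS]mulr_natl expr_div_n mulrA.
rewrite ltr_pdivrMr ?exprn_gt0 // mulrC ltr_pM2l ?exprn_gt0 //.
by rewrite -natrX ltr_nat; nia.
Qed.

Lemma rat_matrix_dense (R : realType) (n1 n2 : nat) (A : 'M[R]_(n1, n2)) (d : R) :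
  0 < d -> exists q : 'M[rat]_(n1, n2), frob (A - map_mx ratr q) < d.
Proof.
move=> d0; set c := d / (n1 * n2).+1%:R.
have c0 : 0 < c by rewrite divr_gt0.
have ex i j : exists q : rat, `|A i j - ratr q| <= c.
  have [q] : exists q : rat, ratr q \in `](A i j - c), (A i j + c)[.
    by apply: rat_in_itvoo; lra.
  rewrite in_itv /= => /andP[h1 h2]; exists q; rewrite ler_norml; lra.
exists (\matrix_(i, j) sval (cid (ex i j))).
apply: frob_le_sup => // i j; by rewrite !mxE; case: cid => q.
Qed.

Lemma measurable_frob d (T : measurableType d) (R : realType) (n1 n2 : nat)
    (A : T -> 'M[R]_(n1, n2)) :
  (forall i j, measurable_fun setT (fun w => A w i j)) ->
  measurable_fun setT (fun w => frob (A w)).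
Proof.
move=> mA; have ms : measurable_fun setT (@Num.sqrt R).
  by apply: continuous_measurable_fun => x; exact: sqrt_continuous.
apply: (measurableT_comp ms).
apply: measurable_sum => i; apply: measurable_sum => j; exact: measurable_funX.
Qed.

(* A 1-Lipschitz function is the infimum of the cones based at the rational points. *)
Lemma measurable_lipschitz d (T : measurableType d) (R : realType) (n1 n2 : nat)
    (A : T -> 'M[R]_(n1, n2)) (g : 'M[R]_(n1, n2) -> R) :
  (forall i j, measurable_fun setT (fun w => A w i j)) ->
  (forall B C, g B <= g C + frob (B - C)) ->
  measurable_fun setT (fun w => g (A w)).
Proof.
move=> mA lip; apply: (measurability _ (RGenInftyO.measurableE R)) => //.
move=> _ [_ [a ->] <-]; rewrite setTI.
pose q (n : nat) : 'M[R]_(n1, n2) := map_mx ratr (odflt 0 (unpickle n : option 'M[rat]_(n1, n2))).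
rewrite (_ : _ @^-1` _ = \bigcup_n [set w | g (q n) + frob (A w - q n) < a]).
  apply: bigcupT_measurable => n.
  have mn : measurable_fun setT (fun w => g (q n) + frob (A w - q n)).
    apply: measurable_funD => //; apply: measurable_frob => i j.
    by under eq_fun do rewrite !mxE; apply: measurable_funB.
  have := mn measurableT _ (measurable_itv `]-oo, a[); rewrite setTI.
  by congr measurable; apply/seteqP; split=> w /=; rewrite in_itv.
apply/seteqP; split=> w /=; rewrite in_itv /=.
  move=> ga; have [|r fr] := @rat_matrix_dense _ _ _ (A w) ((a - g (A w)) / 2).
    by rewrite divr_gt0 // subr_gt0.
  exists (pickle r) => //=; rewrite /q pickleK /=.
  have := lip (map_mx ratr r) (A w).
  have -> : frob (map_mx ratr r - A w) = frob (A w - map_mx ratr r).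
    by congr Num.sqrt; apply: eq_bigr => i _; apply: eq_bigr => j _; rewrite !mxE; ring.
  lra.
by move=> [n _]; apply: le_lt_trans; exact: lip.
Qed.

Lemma measurable_ls_loss d (T : measurableType d) (R : realType) (n1 n2 : nat)
    (A : T -> 'M[R]_(n1, n2)) (theta : 'M[R]_(n1, n2)) :
  (forall i j, measurable_fun setT (fun w => A w i j)) ->
  measurable_fun setT (fun w => frob (ls (theta + A w) - theta)).
Proof.
move=> mA; apply: (@measurable_lipschitz _ _ _ _ _ A (fun B => frob (ls (theta + B) - theta))) => // B C.
have -> : ls (theta + B) - theta = (ls (theta + C) - theta) + (ls (theta + B) - ls (theta + C)).
  by rewrite [RHS]addrC addrA subrK.
apply: le_trans (frobD _ _) _; rewrite lerD2l; apply: le_trans (ls_contraction _ _) _.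
by rewrite opprD addrACA subrr add0r.
Qed.

(** * Sums over scales *)

Lemma sum_half_le (R : realType) (m : nat) : \sum_(a < m) (2^-1 : R) ^+ a <= 2.
Proof.
have h : \sum_(a < m) (2^-1 : R) ^+ a = 2 - 2 * 2^-1 ^+ m.
  elim: m => [|m IH]; first by rewrite big_ord0 expr0; ring.
  by rewrite big_ord_recr /= IH exprS; field.
have := exprn_ge0 m (_ : 0 <= 2^-1 :> R); rewrite h; lra.
Qed.

(** With [c = a + b], the summand is [2^-1 ^+ s] times [2^-1] to the power [|s - c|]; the geometric
    series below and from [c = s] on contribute at most 1 and 2. *)
Lemma sum_scale_weight (R : realType) (s m b : nat) :
  \sum_(a < m) (2^-1 : R) ^+ (a + b) * 4^-1 ^+ (s - (a + b)) <= 3 * 2^-1 ^+ s.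
Proof.
(* The subtracted term lets the induction on [s] close: it pays for the extra first summand
   [4^-1 ^+ s.+1] when [b = 0], while [shift] lowers [s] and [b] together. *)
apply: (@le_trans _ _ ((3 - 2^-1 ^+ s) * 2^-1 ^+ s)); last first.
  by rewrite ler_wpM2r ?exprn_ge0 // gerBl exprn_ge0.
elim: s b m => [|s IH] b m.
  rewrite expr0 mulr1; apply: (@le_trans _ _ (\sum_(a < m) (2^-1 : R) ^+ a)).
    apply: ler_sum => a _; rewrite sub0n expr0 mulr1 exprD ler_piMr ?exprn_ge0 //.
    by rewrite exprn_ile1 // invf_le1 // ler1n.
  by have := sum_half_le R m; lra.
have shift c n : \sum_(a < n) (2^-1 : R) ^+ (a + c.+1) * 4^-1 ^+ (s.+1 - (a + c.+1))
   <= 2^-1 * ((3 - 2^-1 ^+ s) * 2^-1 ^+ s).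
  under eq_bigr do rewrite addnS subSS exprS -mulrA.
  by rewrite -mulr_sumr ler_wpM2l.
have s0 : 0 <= (2^-1 : R) ^+ s by rewrite exprn_ge0.
have e4 : (4^-1 : R) ^+ s = 2^-1 ^+ s * 2^-1 ^+ s.
  by rewrite -exprMn; congr (_ ^+ s); field.
case: b => [|b]; last by apply: le_trans (shift b m) _; rewrite !exprS; nra.
case: m => [|m].
  rewrite big_ord0 mulr_ge0 ?exprn_ge0 // subr_ge0; apply: (@le_trans _ _ 1); last by lra.
  by rewrite exprn_ile1 // invf_le1 // ler1n.
rewrite big_ord_recl /= expr0 mul1r subn0 exprS e4.
have := shift 0%N m; rewrite (eq_bigr (fun a : 'I_m => (2^-1 : R) ^+ (bump 0 a + 0) * 4^-1 ^+ (s.+1 - (bump 0 a + 0)))).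
  by rewrite !exprS; nra.
by move=> a _; rewrite /bump /= addn1 addn0 add1n.
Qed.

Lemma sum_scale_sqrt (R : realType) (s m b : nat) :
  \sum_(a < m) (s - (a + b))%:R * Num.sqrt (2 : R) ^+ (a + b) <= 10 * Num.sqrt 2 ^+ s.
Proof.
set r := Num.sqrt (2 : R).
have r0 : 0 <= r by exact: sqrtr_ge0.
have r2 : r ^+ 2 = 2 by rewrite sqr_sqrtr.
have r14 : 14 / 10 <= r by nra.
(* In this strengthened form the induction step reduces to [(4 - 3 * r) * s + 14 - 10 * r <= 0],
   which [r14] is just enough to give. *)
apply: (@le_trans _ _ (10 * r ^+ s - 3 * s%:R - 10)); last first.
  have : 0 <= s%:R :> R by []. lra.
elim: s b m => [|s IH] b m.
  by rewrite big1 ?expr0 => [|a _]; [lra | rewrite sub0n mul0r].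
have shift c n : \sum_(a < n) (s.+1 - (a + c.+1))%:R * r ^+ (a + c.+1)
   <= r * (10 * r ^+ s - 3 * s%:R - 10).
  under eq_bigr do rewrite addnS subSS exprS mulrCA.
  by rewrite -mulr_sumr ler_wpM2l.
have s0 : 0 <= s%:R :> R by [].
have step : r * (10 * r ^+ s - 3 * s%:R - 10) + s.+1%:R <= 10 * r ^+ s.+1 - 3 * s.+1%:R - 10.
  rewrite exprS -natr1; nra.
have s1 : 0 <= s.+1%:R :> R by [].
case: b => [|b]; last by apply: le_trans (shift b m) _; lra.
case: m => [|m].
  have := shift 0%N 0%N; rewrite !big_ord0; lra.
rewrite big_ord_recl /= expr0 mulr1 subn0.
have := shift 0%N m; rewrite (eq_bigr (fun a : 'I_m => (s.+1 - (bump 0 a + 0))%:R * r ^+ (bump 0 a + 0))).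
  lra.
by move=> a _; rewrite /bump /= addn1 addn0 add1n.
Qed.

Lemma sqrt2X (R : realType) (a : nat) : Num.sqrt (2 ^+ a) = Num.sqrt 2 ^+ a :> R.
Proof.
elim: a => [|a IH]; first by rewrite !expr0 sqrtr1.
by rewrite !exprS sqrtrM // IH.
Qed.

Lemma expR_half_le (R : realType) (k : nat) : expR (k%:R / 2) <= 2 ^+ k :> R.
Proof.
rewrite expRM_natl; apply: lerXn2r; rewrite ?nnegrE ?expR_ge0 //.
rewrite -(ler_pXn2r (n := 2)) ?nnegrE ?expR_ge0 // -expRM_natl divff //.
by have /andP[_] := expR1_bounds R; lra.
Qed.

(** The degree-six Taylor term of the exponential at [k / 2]; the sixth power is the one arising in
    [threshold_sum]. *)
Lemma exprn6_le (R : realType) (k : nat) : (k%:R : R) ^+ 6 <= 2 ^+ 6 * (6`!)%:R * 2 ^+ k.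
Proof.
have k0 : 0 <= k%:R / 2 :> R by rewrite divr_ge0.
have := le_trans (expR_ge1Dxn 5 k0) (expR_half_le R k).
rewrite expr_div_n => h.
have : k%:R ^+ 6 / 2 ^+ 6 / (6`!)%:R <= 2 ^+ k :> R by lra.
rewrite ler_pdivrMr ?ltr0n // ler_pdivrMr ?exprn_gt0 // => /le_trans; apply.
by rewrite [leRHS]mulrC (mulrC (2 ^+ 6)) mulrA.
Qed.

Lemma haar_scale_count (R : realType) (k n : nat) (H : 'M[R]_n) sc (G : nat -> R) :
  haar_system k H sc -> (forall a, 0 <= G a) ->
  \sum_i G (sc i) <= \sum_(a < k.+1) (2 ^ (k - a))%:R * G a.
Proof.
move=> hs G0.
have -> : \sum_i G (sc i) = \sum_i \sum_(a < k.+1 | sc i == a) G a.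
  by apply: eq_bigr => i _; rewrite sum_ord_eq ltnS (haar_le hs).
rewrite (exchange_big_dep xpredT) //=; apply: ler_sum => a _.
rewrite sumr_const -[leLHS]mulr_natl ler_wpM2r // ler_nat.
exact: (haar_card hs).
Qed.

Lemma sum_pow_half (R : realType) (k m : nat) : (m <= k.+1)%N ->
  \sum_(a < m) (2 ^ (k - a))%:R <= 2 * 2 ^+ k :> R.
Proof.
move=> mk; rewrite mulrC; apply: le_trans (ler_wpM2l _ (sum_half_le R m)); last exact: exprn_ge0.
rewrite mulr_sumr; apply: ler_sum => a _; rewrite natrX expfB_cond ?pnatr_eq0 //=; last by have := ltn_ord a; lia.
by rewrite exprVn.
Qed.

(* Coefficients against a constant vector are not controlled by the envelopes, so they get
   threshold 0. *)
Definition scale_gap (k1 k2 s a b : nat) : nat :=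
  if (a < k1)%N && (b < k2)%N then (s - (a + b))%N else 0%N.

(** The first two terms count coefficients against a constant vector, whose weight is 1. Among the
    others, summing over [a] at fixed [b] costs a constant, so only the number [k2] of column scales
    appears, which is the source of [log n2]. *)
Lemma haar_weight_sum (R : realType) (k1 k2 n1 n2 s : nat) (H1 : 'M[R]_n1) sc1 (H2 : 'M[R]_n2) sc2 :
  haar_system k1 H1 sc1 -> haar_system k2 H2 sc2 ->
  \sum_i \sum_j (4^-1 : R) ^+ scale_gap k1 k2 s (sc1 i) (sc2 j)
  <= 2 * 2 ^+ k1 + 2 * 2 ^+ k2 + 3 * k2%:R * 2 ^+ k1 * 2 ^+ k2 * 2^-1 ^+ s.
Proof.
move=> hs1 hs2; pose G a b : R := 4^-1 ^+ scale_gap k1 k2 s a b.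
have G0 a b : 0 <= G a b by rewrite exprn_ge0.
have F0 a : 0 <= \sum_(b < k2.+1) (2 ^ (k2 - b))%:R * G a b.
  by apply: sumr_ge0 => b _; rewrite mulr_ge0.
apply: (@le_trans _ _ (\sum_i \sum_(b < k2.+1) (2 ^ (k2 - b))%:R * G (sc1 i) b)).
  by apply: ler_sum => i _; exact: (haar_scale_count hs2).
apply: le_trans (haar_scale_count hs1 F0) _.
rewrite big_ord_recr /= subnn expn0 mul1r.
have -> : \sum_(b < k2.+1) (2 ^ (k2 - b))%:R * G k1 b = \sum_(b < k2.+1) (2 ^ (k2 - b))%:R.
  by apply: eq_bigr => b _; rewrite /G /scale_gap ltnn /= expr0 mulr1.
have h2 := sum_pow_half R (leqnn k2.+1).
under eq_bigr => a _.
  rewrite big_ord_recr /= subnn expn0 mul1r {2}/G /scale_gap ltnn andbF expr0 mulrDr mulr1.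
  over.
rewrite big_split /=.
have h1 := sum_pow_half R (leqnSn k1).
suff h : \sum_(a < k1) (2 ^ (k1 - a))%:R * (\sum_(b < k2) (2 ^ (k2 - b))%:R * G a b)
   <= 3 * k2%:R * 2 ^+ k1 * 2 ^+ k2 * 2^-1 ^+ s by lra.
have -> : \sum_(a < k1) (2 ^ (k1 - a))%:R * (\sum_(b < k2) (2 ^ (k2 - b))%:R * G a b)
   = 2 ^+ k1 * 2 ^+ k2 * \sum_(b < k2) \sum_(a < k1) (2^-1 : R) ^+ (a + b) * 4^-1 ^+ (s - (a + b)).
  rewrite exchange_big mulr_sumr; apply: eq_bigr => a _; rewrite !mulr_sumr; apply: eq_bigr => b _.
  rewrite /G /scale_gap !ltn_ord /=; set w := (4^-1 : R) ^+ _.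
  rewrite !natrX !expfB_cond ?pnatr_eq0 ?(ltnW (ltn_ord _)) //.
  rewrite exprD !exprVn; ring.
have -> : 3 * k2%:R * 2 ^+ k1 * 2 ^+ k2 * 2^-1 ^+ s = 2 ^+ k1 * 2 ^+ k2 * (3 * 2^-1 ^+ s *+ k2) :> R.
  rewrite -[3 * _ *+ _]mulr_natl; ring.
rewrite ler_wpM2l ?mulr_ge0 ?exprn_ge0 //.
rewrite -[in leRHS](card_ord k2) -sumr_const; apply: ler_sum => b _; exact: sum_scale_weight.
Qed.

(** The sum is at most [k1 * k2 * (k1 + k2)], cubic in the larger level; its square is of degree six
    and is dominated by [2 ^+ k1 + 2 ^+ k2]. *)
Lemma threshold_sum (R : realType) (k1 k2 s : nat) : (s <= k1 + k2)%N ->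
  (\sum_(a < k1) \sum_(b < k2) (s - (a + b))%:R : R) ^+ 2
  <= 4 * (2 ^+ 6 * (6`!)%:R) * (2 ^+ k1 + 2 ^+ k2).
Proof.
move=> sk.
apply: (@le_trans _ _ (4 * (k1%:R ^+ 6 + k2%:R ^+ 6))); last first.
  have := exprn6_le R k1; have := exprn6_le R k2; set c := 2 ^+ 6 * _; lra.
have -> : \sum_(a < k1) \sum_(b < k2) (s - (a + b))%:R
   = (\sum_(a < k1) \sum_(b < k2) (s - (a + b)))%:R :> R.
  by rewrite natr_sum; apply: eq_bigr => a _; rewrite natr_sum.
rewrite -!natrX -natrD -[4]/(4%:R) -natrM ler_nat.
have : (\sum_(a < k1) \sum_(b < k2) (s - (a + b)) <= k1 * (k2 * (k1 + k2)))%N.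
  rewrite -[k1 in leqRHS]card_ord -sum_nat_const; apply: leq_sum => a _.
  rewrite -[k2 in leqRHS]card_ord -sum_nat_const; apply: leq_sum => b _.
  rewrite !card_ord; lia.
set S := (\sum_(a < k1) _)%N => hS.
wlog le12 : k1 k2 sk S hS / (k1 <= k2)%N.
  move=> th; have [?|/ltnW le21] := leqP k1 k2; first exact: th.
  rewrite [X in (4 * X)%N]addnC; apply: th => //; rewrite ?[(k2 + k1)%N]addnC //; nia.
have h : (S <= 2 * k2 ^ 3)%N.
  apply: leq_trans hS _; rewrite !expnS expn0 muln1.
  have := leq_mul le12 (leqnn k2); nia.
apply: (@leq_trans ((2 * k2 ^ 3) ^ 2)); first by rewrite leq_exp2r.
rewrite expnMn -expnM leq_mul // leq_addl //.
Qed.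

(** * Risk bounds *)

Lemma exists_dyadic_level (n : nat) : (0 < n)%N -> exists k, (n <= 2 ^ k <= 2 * n)%N.
Proof.
move=> n0; exists (up_log 2 n); have [n1|n1] := leqP n 1.
  by have -> : n = 1%N by lia.
have /andP[h1 h2] := up_log_bounds (isT : (1 < 2)%N) n1.
have : (0 < up_log 2 n)%N by rewrite up_log_gt0.
rewrite h2 /=; move: h1; case: (up_log 2 n) => // k; rewrite expnS /=; lia.
Qed.

(** Where [|z|] exceeds the threshold, [z ^ 2] exceeds the squared excess by at least
    [16 * sigma ^ 2 * t ^ 2], hence by [16 * sigma ^ 2 * t] as [t] is an integer. Dividing by
    [4 * sigma ^ 2] leaves [expR (- 4 t) <= 4^-1 ^+ t]. *)
Lemma expR_excess_le (R : realType) (sigma z : R) (t : nat) : 0 < sigma ->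
  expR (excess (4 * sigma * t%:R) z ^+ 2 / (4 * sigma ^+ 2))
  <= 1 + 4^-1 ^+ t * expR ((z / sigma) ^+ 2 / 4).
Proof.
move=> s0; have sn0 : sigma != 0 by rewrite gt_eqF.
have p0 : 0 <= 4^-1 ^+ t * expR ((z / sigma) ^+ 2 / 4) by rewrite mulr_ge0 ?expR_ge0 // exprn_ge0.
rewrite /excess; case: (leP (`|z| - 4 * sigma * t%:R) 0) => h.
  by rewrite expr0n mul0r expR0 lerDl.
apply: (@le_trans _ _ (4^-1 ^+ t * expR ((z / sigma) ^+ 2 / 4))); last by rewrite lerDr.
have e4 : expR (- (4 * t%:R)) <= 4^-1 ^+ t :> R.
  rewrite -mulNr expRM_natr; apply: lerXn2r; rewrite ?nnegrE ?expR_ge0 //.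
  rewrite expRN lef_pV2 ?posrE ?expR_gt0 //; have := expR_ge1Dx (4 : R); lra.
apply: (@le_trans _ _ (expR (- (4 * t%:R)) * expR ((z / sigma) ^+ 2 / 4))); last first.
  by rewrite ler_wpM2r ?expR_ge0.
rewrite -expRD ler_expR -(subr_ge0 _ (_ + _)).
have -> : - (4 * t%:R) + (z / sigma) ^+ 2 / 4 - (`|z| - 4 * sigma * t%:R) ^+ 2 / (4 * sigma ^+ 2)
   = ((z ^+ 2 - (`|z| - 4 * sigma * t%:R) ^+ 2 - 16 * sigma ^+ 2 * t%:R)) / (4 * sigma ^+ 2).
  by field.
apply: divr_ge0; last by rewrite mulr_ge0 // sqr_ge0.
have t2 : t%:R <= t%:R ^+ 2 :> R by rewrite -natrX ler_nat; nia.
have t0 : 0 <= t%:R :> R by [].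
rewrite -(real_normK (num_real z)).
have st : 0 <= sigma * t%:R by rewrite mulr_ge0 // ltW.
have h1 : 0 <= sigma * t%:R * (`|z| - 4 * sigma * t%:R) by rewrite mulr_ge0 // ltW.
have h2 : sigma ^+ 2 * t%:R <= sigma ^+ 2 * t%:R ^+ 2 by rewrite ler_wpM2l ?sqr_ge0.
nra.
Qed.

Lemma measurable_ortho_coef d (T : measurableType d) (R : realType) (n1 n2 : nat)
    (eps : T -> 'M[R]_(n1, n2)) (H1 : 'M[R]_n1) (H2 : 'M[R]_n2) i j :
  (forall i j, measurable_fun setT (fun w => eps w i j)) ->
  measurable_fun setT (fun w => (H1 *m eps w *m H2^T) i j).
Proof.
move=> meps; under eq_fun do rewrite mulmx_bil /bil.
apply: measurable_sum => k; apply: measurable_sum => l.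
by apply: measurable_funM => //; apply: measurable_funM.
Qed.

(** The test matrix [H1^T *m V *m H2] has the Frobenius norm of [V] by Parseval, so the normalized
    coefficients are jointly sub-Gaussian with proxy 1. *)
Lemma subG_ortho d (T : measurableType d) (R : realType) (P : probability T R) (n1 n2 : nat)
    (eps : T -> 'M[R]_(n1, n2)) (sigma : R) (H1 : 'M[R]_n1) (H2 : 'M[R]_n2) :
  0 < sigma -> subG P eps (sigma ^+ 2) -> H1 *m H1^T = 1%:M -> H2 *m H2^T = 1%:M ->
  forall v : 'I_n1 * 'I_n2 -> R,
  (\int[P]_w (expR (\sum_p v p * ((H1 *m eps w *m H2^T) p.1 p.2 / sigma)))%:E
     <= (expR ((\sum_p v p ^+ 2) / 2))%:E)%E.
Proof.
move=> s0 [_ _ _ mgf] o1 o2 v; have sn0 : sigma != 0 by rewrite gt_eqF.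
pose V : 'M[R]_(n1, n2) := \matrix_(i, j) (v (i, j) / sigma).
pose M := H1^T *m V *m H2.
have HM : H1 *m M *m H2^T = V.
  by rewrite /M !mulmxA o1 mul1mx -mulmxA o2 mulmx1.
have := mgf M; rewrite unlock.
have -> : sigma ^+ 2 * frob M ^+ 2 / 2 = (\sum_p v p ^+ 2) / 2.
  rewrite frob_dotm -(dotm_ortho M M o1 o2) HM -frob_dotm frob_sqr pair_bigA mulr_sumr.
  by congr (_ / 2); apply: eq_bigr => -[i j] _ /=; rewrite mxE expr_div_n; field.
apply: le_trans; rewrite le_eqVlt; apply/orP; left; apply/eqP; apply: eq_integral => w _.
congr (expR _)%:E; rewrite -dotmE -(dotm_ortho _ _ o1 o2) HM /dotm pair_bigA.
by apply: eq_bigr => -[i j] _ /=; rewrite [V i j]mxE; field.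
Qed.

(** [exp_quadratic] in the rotated coordinates feeds [exp_moment]; [1 + 64 * q p <= expR (64 * q p)]
    turns the product into [expR B]. *)
Lemma loss_of_noise d (T : measurableType d) (R : realType) (P : probability T R) (n1 n2 : nat)
    (eps : T -> 'M[R]_(n1, n2)) (sigma : R) (H1 : 'M[R]_n1) (H2 : 'M[R]_n2)
    (q : 'I_n1 * 'I_n2 -> R) (X Y : T -> R) (c D B x r : R) :
  0 < sigma -> subG P eps (sigma ^+ 2) -> H1 *m H1^T = 1%:M -> H2 *m H2^T = 1%:M ->
  (forall p, 0 <= q p) -> 64 * \sum_p q p <= B ->
  measurable_fun setT X -> measurable_fun setT Y ->
  (forall w, 0 <= X w) -> (forall w, 0 <= Y w) -> 0 < c -> 0 <= D -> 0 <= x ->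
  (forall w, X w <= c * (D + Y w)) -> c * (D + B + x) <= r ->
  (forall w, expR (Y w) <= \prod_p (1 + q p * expR (((H1 *m eps w *m H2^T) p.1 p.2 / sigma) ^+ 2 / 4))) ->
  ((1 - expR (- x))%:E <= P [set w | (X w <= r)%R])%E /\ ('E_P[X] <= r%:E)%E.
Proof.
move=> s0 sg o1 o2 q0 qB mX mY X0 Y0 c0 D0 x0 XY cr EY.
have sq0 : 0 <= \sum_p q p by exact: sumr_ge0.
have B0 : 0 <= B by apply: le_trans qB; rewrite mulr_ge0.
have meps := let: And4 h _ _ _ := sg in h.
pose Z (p : 'I_n1 * 'I_n2) w := (H1 *m eps w *m H2^T) p.1 p.2 / sigma.
have mZ p : measurable_fun setT (Z p).
  by apply: measurable_funM => //; exact: measurable_ortho_coef.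
apply: (@exp_moment _ _ _ P X Y c D B x r) => //.
apply: (@le_trans _ _ (\int[P]_w (\prod_p (1 + q p * expR (Z p w ^+ 2 / 4)))%:E)%E).
  apply: ge0_le_integral => //.
  - by apply/measurable_EFinP; apply: measurableT_comp.
  - apply/measurable_EFinP; apply: measurable_prod => p _; apply: measurable_funD => //.
    apply: measurable_funM => //; apply: measurableT_comp => //; apply: measurable_funM => //.
    exact: measurable_funX.
  - by move=> w _; rewrite lee_fin; exact: EY.
apply: le_trans (exp_quadratic mZ q0 (subG_ortho s0 sg o1 o2)) _.
rewrite lee_fin; apply: (@le_trans _ _ (expR (64 * \sum_p q p))); last by rewrite ler_expR.
rewrite mulr_sumr expR_sum; apply: ler_prod => p _; rewrite expR_ge1Dx andbT.
by rewrite addr_ge0 // mulr_ge0.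
Qed.

(** The basic inequality and Cauchy-Schwarz bound the error by the norm of the noise, treated in the
    standard basis with all weights 1. As [n1 <= N], the constant is 4 * (64 + 1). *)
Lemma loss_noise_level d (T : measurableType d) (R : realType) (P : probability T R) (n1 n2 : nat)
    (eps : T -> 'M[R]_(n1.+1, n2.+1)) (theta : 'M[R]_(n1.+1, n2.+1)) (sigma : R) :
  0 < sigma -> subG P eps (sigma ^+ 2) -> anti_monge theta ->
  let N : R := n1.+1%:R * n2.+1%:R in
  let loss w := N^-1 * frob (ls (theta + eps w) - theta) ^+ 2 in
  ((1 - expR (- n1.+1%:R))%:E <= P [set w | (loss w <= 260 * sigma ^+ 2)%R])%E
  /\ ('E_P[loss] <= (260 * sigma ^+ 2)%:E)%E.
Proof.
move=> s0 sg mth N loss; have meps := let: And4 h _ _ _ := sg in h.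
have sn0 : sigma != 0 by rewrite gt_eqF.
have N0 : 0 < N by rewrite mulr_gt0.
have nN : n1.+1%:R <= N by rewrite ler_peMr ?ler1n.
pose Y w := frob (eps w) ^+ 2 / (4 * sigma ^+ 2).
have c0 : 0 < 4 * sigma ^+ 2 / N by rewrite divr_gt0 // mulr_gt0 // exprn_gt0.
have id1 m : 1%:M *m 1%:M^T = 1%:M :> 'M[R]_m by rewrite trmx1 mulmx1.
apply: (@loss_of_noise _ _ _ P _ _ eps sigma 1%:M 1%:M (fun=> 1) loss Y
   (4 * sigma ^+ 2 / N) 0 (64 * N) n1.+1%:R _ s0 sg (id1 _) (id1 _)).
- by [].
- by rewrite sumr_const card_prod !card_ord natrM.
- by apply: measurable_funM => //; apply: measurable_funX; exact: measurable_ls_loss.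
- by apply: measurable_funM => //; apply: measurable_funX; exact: measurable_frob.
- by move=> w; rewrite mulr_ge0 ?sqr_ge0 // invr_ge0 ltW.
- by move=> w; rewrite divr_ge0 ?sqr_ge0 // mulr_ge0 // sqr_ge0.
- exact: c0.
- by [].
- by [].
- move=> w; have := ls_basic (eps w) mth; rewrite /loss /Y; set t := ls _ - theta => h.
  have hh : frob t ^+ 2 <= frob (eps w) ^+ 2.
    have := le_trans h (dotm_le_frob _ _).
    have := sqrtr_ge0 (\sum_i \sum_j t i j ^+ 2); rewrite -/(frob t).
    have := sqrtr_ge0 (\sum_i \sum_j (eps w) i j ^+ 2); rewrite -/(frob (eps w)); nra.
  rewrite add0r [leRHS](_ : _ = N^-1 * frob (eps w) ^+ 2).
    by rewrite ler_wpM2l // invr_ge0 ltW.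
  by field; rewrite sn0 gt_eqF.
- by rewrite mulrAC ler_pdivrMr // add0r; have := sqr_ge0 sigma; nra.
- move=> w; rewrite /Y frob_sqr pair_bigA mulr_suml expR_sum; apply: ler_prod => -[i j] _ /=.
  rewrite expR_ge0 /= mul1mx trmx1 mulmx1 mul1r.
  apply: (@le_trans _ _ (expR ((eps w i j / sigma) ^+ 2 / 4))); last by rewrite lerDr.
  by rewrite ler_expR le_eqVlt; apply/orP; left; apply/eqP; field.
Qed.

Lemma measurable_excess d (T : measurableType d) (R : realType) (f : T -> R) (tau : R) :
  measurable_fun setT f -> measurable_fun setT (fun w => excess tau (f w)).
Proof.
move=> mf; apply: measurable_maxr => //; apply: measurable_funB => //.
exact: measurableT_comp.
Qed.

Lemma corner_variation_ge0 (R : realType) (m1 m2 : nat) (A : 'M[R]_(m1.+1, m2.+1)) :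
  anti_monge A -> 0 <= corner_variation A.
Proof.
move=> /(_ ord0 ord_max ord0 ord_max isT isT); rewrite /corner_variation; lra.
Qed.

(** If [s] is maximal, the last term is [3 * k2 <= 6 * n1]; otherwise [x] replaces [2^-1 ^+ s]. The
    factor 900 covers 64 * (4 + 4 + 6) and 64 * 12. *)
Lemma weight_le_level (R : realType) (k1 k2 n1 n2 s : nat) (x : R) :
  (n2 <= n1)%N -> (2 ^ k1 <= 2 * n1)%N -> (2 ^ k2 <= 2 * n2)%N ->
  s = (k1 + k2)%N \/ 2^-1 ^+ s <= x -> 0 <= x ->
  64 * (2 * 2 ^+ k1 + 2 * 2 ^+ k2 + 3 * k2%:R * 2 ^+ k1 * 2 ^+ k2 * 2^-1 ^+ s)
  <= 900 * (n1%:R + n1%:R * n2%:R * k2%:R * x).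
Proof.
move=> n21 h1 h2 sx x0.
have n21R : n2%:R <= n1%:R :> R by rewrite ler_nat.
have p1 : 2 ^+ k1 <= 2 * n1%:R :> R by rewrite -natrX -natrM ler_nat.
have p2 : 2 ^+ k2 <= 2 * n2%:R :> R by rewrite -natrX -natrM ler_nat.
have k2n : k2%:R <= 2 * n2%:R :> R.
  by apply: le_trans p2; rewrite -natrX ler_nat ltnW // ltn_expl.
have W0 : 0 <= n1%:R * n2%:R * k2%:R * x by rewrite !mulr_ge0.
suff : 3 * k2%:R * 2 ^+ k1 * 2 ^+ k2 * 2^-1 ^+ s <= 6 * n1%:R + 12 * (n1%:R * n2%:R * k2%:R * x).
  by have : 0 <= n1%:R :> R by []; lra.
case: sx => [->|sx].
  have -> : 3 * k2%:R * 2 ^+ k1 * 2 ^+ k2 * 2^-1 ^+ (k1 + k2) = 3 * k2%:R :> R.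
    by rewrite exprD !exprVn; field; rewrite !expf_neq0.
  lra.
have h : 2 ^+ k1 * 2 ^+ k2 <= 4 * (n1%:R * n2%:R) :> R.
  have -> : 4 * (n1%:R * n2%:R) = 2 * n1%:R * (2 * n2%:R) :> R by ring.
  by apply: ler_pM.
apply: (@le_trans _ _ (3 * k2%:R * (4 * (n1%:R * n2%:R)) * x)).
  by rewrite -(mulrA _ (2 ^+ k1)); apply: ler_pM; rewrite ?mulr_ge0 ?exprn_ge0 // ler_wpM2l // mulr_ge0.
have -> : 3 * k2%:R * (4 * (n1%:R * n2%:R)) * x = 12 * (n1%:R * n2%:R * k2%:R * x) by ring.
by rewrite lerDr mulr_ge0.
Qed.

Lemma ls_haar_bound (R : realType) (m1 m2 k1 k2 s : nat) (H1 : 'M[R]_m1.+1) sc1 (H2 : 'M[R]_m2.+1) sc2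
    (theta e : 'M[R]_(m1.+1, m2.+1)) (sigma x : R) :
  haar_system k1 H1 sc1 -> haar_system k2 H2 sc2 -> anti_monge theta -> 0 < sigma ->
  (m2 <= m1)%N -> (2 ^ k1 <= 2 * m1.+1)%N -> (2 ^ k2 <= 2 * m2.+1)%N -> (s <= k1 + k2)%N ->
  let N : R := m1.+1%:R * m2.+1%:R in
  corner_variation theta * Num.sqrt 2 ^+ s <= 2 * sigma * N * x ->
  frob (ls (theta + e) - theta) ^+ 2
  <= sigma ^+ 2 * (512 * (16 * (2 ^+ 6 * (6`!)%:R)) * m1.+1%:R + 320 * (N * k2%:R * x))
     + 2 * \sum_i \sum_j excess (4 * sigma * (scale_gap k1 k2 s (sc1 i) (sc2 j))%:R)
         ((H1 *m e *m H2^T) i j) ^+ 2.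
Proof.
move=> hs1 hs2 mth s0 m21 kn1 kn2 sk N Vx.
have [mls _] := lsP (theta + e).
(* Truncated subtraction makes the threshold vanish as soon as [a + b >= s]. *)
pose tau a b : R := 4 * sigma * (s - (a + b))%:R.
have tau0 a b : 0 <= tau a b by rewrite /tau !mulr_ge0 // ltW.
have := haar_bound hs1 hs2 mth mls tau0 (ls_basic e mth).
set F := \sum_i \sum_j excess (if _ then _ else _) _ ^+ 2.
have -> : F = \sum_i \sum_j excess (4 * sigma * (scale_gap k1 k2 s (sc1 i) (sc2 j))%:R)
         ((H1 *m e *m H2^T) i j) ^+ 2.
  apply: eq_bigr => i _; apply: eq_bigr => j _; congr (excess _ _ ^+ 2).
  by rewrite /scale_gap /tau; case: ifP => // _; rewrite mulr0.
set V := corner_variation theta.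
set Th := \sum_(a < k1) _; set La := \sum_(a < k1) _ => /le_trans; apply; rewrite lerD2r.
have V0 : 0 <= V by exact: corner_variation_ge0.
rewrite [leRHS]mulrDr; apply: lerD.
  have -> : Th = 4 * sigma * \sum_(a < k1) \sum_(b < k2) (s - (a + b))%:R.
    by rewrite mulr_sumr; apply: eq_bigr => a _; rewrite mulr_sumr.
  have := threshold_sum R sk; rewrite exprMn; set c := 2 ^+ 6 * _; set S := (\sum_(a < k1) _) ^+ 2.
  have c0 : 0 <= c by rewrite mulr_ge0 ?exprn_ge0.
  have p : 2 ^+ k1 + 2 ^+ k2 <= 4 * m1.+1%:R :> R.
    rewrite -!natrX -natrD -natrM ler_nat; lia.
  have h1 := ler_wpM2l c0 p; have v0 := sqr_ge0 sigma; rewrite exprMn.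
  move: h1 v0 {c0 p}; move: (2 ^+ k1 + 2 ^+ k2) (m1.+1%:R) (sigma ^+ 2) c S; clear=> p n v c S h1 v0 h2.
  have h3 : S <= 16 * c * n by lra.
  by have := ler_wpM2l v0 h3; lra.
have LaB : La <= 40 * sigma * k2%:R * Num.sqrt 2 ^+ s.
  rewrite /La exchange_big.
  apply: (@le_trans _ _ (\sum_(b < k2) 40 * sigma * Num.sqrt 2 ^+ s)).
    apply: ler_sum => b _; have h4 : 0 <= 4 * sigma by rewrite mulr_ge0 // ltW.
    have := ler_wpM2l h4 (sum_scale_sqrt R s k1 b); rewrite mulr_sumr => h.
    rewrite [leRHS](_ : _ = 4 * sigma * (10 * Num.sqrt 2 ^+ s)); last by ring.
    apply: le_trans h; apply: ler_sum => a _.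
    by rewrite /tau !sqrt2X exprD -!mulrA.
  by rewrite sumr_const card_ord -[leLHS]mulr_natl le_eqVlt; apply/orP; left; apply/eqP; ring.
have := ler_wpM2l V0 LaB.
have h5 : 0 <= 160 * sigma * k2%:R by rewrite !mulr_ge0 // ltW.
have := ler_wpM2l h5 Vx; rewrite -/V {LaB Vx h5}.
move: (Num.sqrt 2 ^+ s) (k2%:R : R) (La) (N); clear=> t k La N h1 h2; lra.
Qed.

Lemma loss_haar_level (R : realType) : exists2 K : R, 0 < K &
  forall (m1 m2 k1 k2 s : nat) (sigma x r : R) (theta : 'M[R]_(m1.+1, m2.+1))
    d (T : measurableType d) (P : probability T R) (eps : T -> 'M[R]_(m1.+1, m2.+1)),
  0 < sigma -> subG P eps (sigma ^+ 2) -> anti_monge theta ->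
  (m2 <= m1)%N -> (m1.+1 <= 2 ^ k1 <= 2 * m1.+1)%N -> (m2.+1 <= 2 ^ k2 <= 2 * m2.+1)%N ->
  (s <= k1 + k2)%N -> s = (k1 + k2)%N \/ 2^-1 ^+ s <= x -> 0 <= x ->
  let N : R := m1.+1%:R * m2.+1%:R in
  corner_variation theta * Num.sqrt 2 ^+ s <= 2 * sigma * N * x ->
  K * (sigma ^+ 2 / N * (m1.+1%:R + N * k2%:R * x)) <= r ->
  let loss w := N^-1 * frob (ls (theta + eps w) - theta) ^+ 2 in
  ((1 - expR (- m1.+1%:R))%:E <= P [set w | (loss w <= r)%R])%E /\ ('E_P[loss] <= r%:E)%E.
Proof.
have [c cE c0] : exists2 c : R, 512 * (16 * (2 ^+ 6 * (6`!)%:R)) = c & 0 <= c.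
  eexists; first reflexivity.
  exact: mulr_ge0 (ler0n _ _) (mulr_ge0 (ler0n _ _) (mulr_ge0 (exprn_ge0 _ (ler0n _ _)) (ler0n _ _))).
have [K0 [K00 K08 K0c]] : exists K0 : R, [/\ 0 < K0, 320 <= K0 & c <= K0].
  by exists (c + 320); split; lra.
(* [D + 900 * D + n1 <= 902 * D], while [K0] dominates the coefficients of the deterministic terms
   and of the excess sum. *)
exists (902 * K0); first by apply: mulr_gt0; first rewrite ltr0n.
move=> m1 m2 k1 k2 s sigma x r theta d T P eps s0 sg mth m21 /andP[nk1 kn1] /andP[nk2 kn2] sk sx x0 N Vx Dr loss.
have meps := let: And4 h _ _ _ := sg in h.
have sn0 : sigma != 0 by rewrite gt_eqF.
have s20 : 0 < sigma ^+ 2 by rewrite exprn_gt0.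
have N0 : 0 < N by rewrite mulr_gt0.
have [H1 [sc1 hs1]] := @haar_exists R k1 m1.+1 isT (introT andP (conj nk1 kn1)).
have [H2 [sc2 hs2]] := @haar_exists R k2 m2.+1 isT (introT andP (conj nk2 kn2)).
pose W := N * k2%:R * x.
have W0 : 0 <= W by rewrite !mulr_ge0 // ltW.
pose n1 : R := m1.+1%:R; have n10 : 0 <= n1 by rewrite ler0n.
pose D := n1 + W; have D0 : 0 <= D by rewrite addr_ge0.
pose F w := \sum_i \sum_j excess (4 * sigma * (scale_gap k1 k2 s (sc1 i) (sc2 j))%:R)
  ((H1 *m eps w *m H2^T) i j) ^+ 2.
pose Y w := F w / (4 * sigma ^+ 2).
pose q (p : 'I_m1.+1 * 'I_m2.+1) : R := 4^-1 ^+ scale_gap k1 k2 s (sc1 p.1) (sc2 p.2).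
have v0 : 0 <= 4 * sigma ^+ 2 by rewrite mulr_ge0 // ltW.
have Y0 w : 0 <= Y w.
  by rewrite divr_ge0 //; apply: sumr_ge0 => i _; apply: sumr_ge0 => j _; exact: sqr_ge0.
have e0 : 0 < K0 * sigma ^+ 2 / N by apply: divr_gt0 => //; exact: mulr_gt0.
apply: (@loss_of_noise _ _ _ P _ _ eps sigma H1 H2 q loss Y (K0 * sigma ^+ 2 / N) D
  (900 * D) n1 r s0 sg (haar_ortho hs1) (haar_ortho hs2) _ _ _ _ _ Y0 e0 D0 n10).
- by move=> p; rewrite exprn_ge0.
- apply: le_trans (@weight_le_level R k1 k2 m1.+1 m2.+1 s x m21 kn1 kn2 sx x0); rewrite ler_pM2l //.
  have -> : \sum_p q p = \sum_i \sum_j (4^-1 : R) ^+ scale_gap k1 k2 s (sc1 i) (sc2 j).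
    by rewrite pair_bigA.
  exact: haar_weight_sum hs1 hs2.
- by apply: measurable_funM => //; apply: measurable_funX; exact: measurable_ls_loss.
- apply: measurable_funM => //; apply: measurable_sum => i; apply: measurable_sum => j.
  by apply: measurable_funX; apply: measurable_excess; exact: measurable_ortho_coef.
- by move=> w; rewrite mulr_ge0 ?sqr_ge0 // invr_ge0 ltW.
- move=> w; have := ls_haar_bound (eps w) hs1 hs2 mth s0 m21 kn1 kn2 sk Vx.
  rewrite cE -/(F w) -/n1 -/N -/W => bound.
  rewrite /loss mulrC ler_pdivrMr // [leRHS](_ : _ = sigma ^+ 2 * (K0 * (D + Y w))); last first.
    by field; rewrite gt_eqF.
  apply: le_trans bound _.
  have -> : F w = 4 * sigma ^+ 2 * Y w by rewrite /Y; field.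
  rewrite [leLHS](_ : _ = sigma ^+ 2 * (c * n1 + 320 * W + 8 * Y w)); last by ring.
  rewrite ler_pM2l // /D !mulrDr; apply: lerD; first by apply: lerD; rewrite ler_wpM2r.
  by rewrite ler_wpM2r //; lra.
- apply: le_trans Dr; rewrite -/n1 -/W -/D.
  rewrite [leRHS](_ : _ = K0 * sigma ^+ 2 / N * (902 * D)); last by ring.
  rewrite ler_pM2l //; have : n1 <= D by rewrite lerDl.
  by move: D0; move: (D) (n1); clear=> D n; lra.
- move=> w; rewrite /Y /F pair_bigA mulr_suml expR_sum; apply: ler_prod => -[i j] _ /=.
  by rewrite expR_ge0 /=; exact: expR_excess_le.
Qed.

(** * Choice of the cutoff and conversion to the stated rate *)

Lemma exists_cutoff (R : realType) (x : R) (k : nat) : x <= 2 ->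
  exists s, [/\ (s <= k)%N, 2 ^+ s * x <= 2 & s = k \/ 2^-1 ^+ s <= x].
Proof.
(* The result is the largest [s] up to [k] with [2 ^+ s * x <= 2]: if [s] is not capped by [k],
   failure at [s.+1] gives [2^-1 ^+ s <= x]. The capped case includes [x = 0], that is, zero
   variation. *)
move=> x2; elim: k => [|k [s [sk sx kx]]].
  by exists 0%N; split=> //; [rewrite mul1r | left].
case: kx => [sE|h]; last by exists s; split=> //; [exact: leqW | right].
subst s; have [h|h] := leP (2 ^+ k.+1 * x) 2.
  by exists k.+1; split=> //; left.
exists k; split=> //; right; rewrite exprVn.
have k0 : 0 < 2 ^+ k :> R by rewrite exprn_gt0.
by rewrite -[_^-1]mul1r ler_pdivrMr //; move: h; rewrite exprS; lra.
Qed.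

Lemma ln2_ge_half (R : realType) : 2^-1 <= ln (2 : R).
Proof.
have := expR_half_le R 1; rewrite expr1 => h.
by rewrite -ler_expR lnK ?posrE // -[2^-1]mul1r.
Qed.

(** For [n] at least 2, [2 ^ k <= 2 * n <= n ^ 2], and [ln 2] is at least one half. *)
Lemma level_le_ln (R : realType) (n k : nat) : (1 < n)%N -> (2 ^ k <= 2 * n)%N ->
  k%:R <= 4 * ln (n%:R : R).
Proof.
move=> n1 kn; have n0 : 0 < n%:R :> R by rewrite ltr0n; lia.
have : ln (2 ^+ k : R) <= ln (n%:R ^+ 2).
  by rewrite ler_ln ?posrE ?exprn_gt0 // -!natrX ler_nat (leq_trans kn) // -mulnn leq_mul2r n1 orbT.
rewrite !lnXn // -[ln 2 *+ k]mulr_natl -[ln n%:R *+ 2]mulr_natl => h.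
have := ln2_ge_half R; have : 0 <= k%:R :> R by []. nra.
Qed.

(* With [v = V / (sigma N)] one has [rho = v ^ (2/3)], so that [v = rho ^ (3/2)]. *)
Lemma cutoff_variation (R : realType) (V sigma N : R) (s : nat) :
  0 <= V -> 0 < sigma -> 0 < N ->
  let rho := (V / (sigma * N)) `^ (2 / 3) in
  2 ^+ s * rho <= 2 -> V * Num.sqrt 2 ^+ s <= 2 * sigma * N * rho.
Proof.
move=> V0 s0 N0 rho; pose v := V / (sigma * N); pose y := v `^ (1 / 3).
have sN : 0 < sigma * N by rewrite mulr_gt0.
have v0 : 0 <= v by rewrite divr_ge0 // ltW.
have y0 : 0 <= y by exact: powR_ge0.
have y3 : y ^+ 3 = v.
  rewrite -powR_mulrn // -powRrM [X in _ `^ X](_ : _ = 1) ?powRr1 //; by field.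
have y2 : y ^+ 2 = rho.
  rewrite -powR_mulrn // -powRrM [X in _ `^ X](_ : _ = 2 / 3) //; by field.
rewrite -y2 => h; pose t := Num.sqrt 2 ^+ s : R.
have t0 : 0 <= t by rewrite exprn_ge0 ?sqrtr_ge0.
have t2 : t ^+ 2 = 2 ^+ s by rewrite exprAC sqr_sqrtr.
have yt : y * t <= 2.
  have : (y * t) ^+ 2 <= 2 by rewrite exprMn t2 mulrC.
  by have := mulr_ge0 y0 t0; nra.
have -> : V = v * (sigma * N) by rewrite divfK // gt_eqF.
rewrite -y3 -/t [leLHS](_ : _ = sigma * N * (y ^+ 2 * (y * t))); last by ring.
rewrite [leRHS](_ : _ = sigma * N * (y ^+ 2 * 2)); last by ring.
by rewrite ler_pM2l // ler_wpM2l ?sqr_ge0.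
Qed.

Lemma powR_rate (R : realType) (V sigma N : R) : 0 <= V -> 0 < sigma -> 0 < N ->
  (sigma ^+ 2 * V / N) `^ (2 / 3) = sigma ^+ 2 * (V / (sigma * N)) `^ (2 / 3).
Proof.
move=> V0 s0 N0; have sn0 : sigma != 0 by rewrite gt_eqF.
have -> : sigma ^+ 2 * V / N = sigma ^+ 3 * (V / (sigma * N)) by field; rewrite sn0 gt_eqF.
rewrite powRM ?exprn_ge0 ?divr_ge0 ?mulr_ge0 ?(ltW s0) ?(ltW N0) //.
rewrite -(powR_mulrn 3) ?(ltW s0) // -powRrM [X in _ `^ X](_ : _ = 2%:R) ?powR_mulrn ?(ltW s0) //.
by field.
Qed.

Lemma ln_le_geomean (R : realType) (a b : R) : 0 <= b -> b <= a ->
  b <= a `^ (1 / 3) * b `^ (2 / 3).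
Proof.
move=> b0 ba; have a0 := le_trans b0 ba.
apply: (@le_trans _ _ (b `^ (1 / 3) * b `^ (2 / 3))).
  have [->|bn0] := eqVneq b 0; first by rewrite mulr_ge0 ?powR_ge0.
  rewrite -powRD; last by rewrite bn0 implybT.
  by rewrite [X in _ `^ X](_ : _ = 1) ?powRr1 //; field.
rewrite ler_wpM2r ?powR_ge0 //; apply: ge0_ler_powR; rewrite ?nnegrE //.
Qed.

(* The dimensions are n1 = m1.+1 and n2 = m2.+1, so that n1 >= n2 >= 1. *)
Theorem theorem1 (R : realType) :
  exists2 C : R, 0 < C &
  forall (m1 m2 : nat) (sigma : R) (theta : 'M[R]_(m1.+1, m2.+1))
      (d : measure_display) (T : measurableType d) (P : probability T R)
      (eps : T -> 'M[R]_(m1.+1, m2.+1)),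
    (m2.+1 <= m1.+1)%N ->
    0 < sigma ->
    anti_monge theta ->
    subG P eps (sigma ^+ 2) ->
    let n1 : R := m1.+1%:R in
    let n2 : R := m2.+1%:R in
    let y (w : T) : 'M[R]_(m1.+1, m2.+1) := theta + eps w in
    let loss (w : T) := (n1 * n2)^-1 * frob (ls (y w) - theta) ^+ 2 in
    let rate : R :=
      Num.min
        (sigma ^+ 2 / n2
         + (sigma ^+ 2 * corner_variation theta / (n1 * n2)) `^ (2 / 3)
           * ln n1 `^ (1 / 3) * ln n2 `^ (2 / 3))
        (sigma ^+ 2) in
    ((1 - expR (- n1))%:E <= P [set w | (loss w <= C * rate)%R])%E
    /\ ('E_P[loss] <= (C * rate)%:E)%E.
Proof.
have [K K0 levels] := loss_haar_level R.
(* 260 serves the [sigma ^+ 2] branch of the minimum; the factor 4 converts [k2] into logarithms. *)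
exists (4 * K + 260); first by apply: addr_gt0; [apply: mulr_gt0|]; rewrite ?ltr0n.
move=> m1 m2 sigma theta d T P eps m21 s0 mth sg n1 n2 y loss.
set V := corner_variation theta; set A := sigma ^+ 2 / n2 + _; cbv zeta.
have V0 : 0 <= V by exact: corner_variation_ge0.
have n10 : 0 < n1 by rewrite ltr0n.
have n20 : 0 < n2 by rewrite ltr0n.
have N0 : 0 < n1 * n2 by rewrite mulr_gt0.
have v0 : 0 < sigma ^+ 2 by rewrite exprn_gt0.
have weaken r r' : r <= r' ->
    ((1 - expR (- n1))%:E <= P [set w | (loss w <= r)%R])%E /\ ('E_P[loss] <= r%:E)%E ->
    ((1 - expR (- n1))%:E <= P [set w | (loss w <= r')%R])%E /\ ('E_P[loss] <= r'%:E)%E.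
  have mloss a : measurable [set w | loss w <= a].
    rewrite -[X in measurable X]setTI; apply: measurable_fun_le => //.
    apply: measurable_funM => //; apply: measurable_funX; apply: measurable_ls_loss.
    by case: sg.
  move=> rr' [h1 h2]; split; last by apply: le_trans h2 _; rewrite lee_fin.
  apply: le_trans h1 _; apply: le_measure; rewrite ?inE //.
  by move=> w /= /le_trans; apply.
have [vA|Av] := leP (sigma ^+ 2) A.
  apply: weaken (loss_noise_level s0 sg mth).
  by rewrite ler_pM2r // lerDr mulr_ge0 // ltW.
(* If [n2 = 1] then [A] is at least [sigma ^+ 2], the case already treated; so [n2 >= 2] and [ln n2]
   is bounded below. *)
have m20 : (0 < m2)%N.
  rewrite lt0n; apply/eqP => m20; move: Av; rewrite ltNge => /negP; apply.
  rewrite /A /n2 m20 divr1 lerDl mulr_ge0 ?mulr_ge0 ?powR_ge0 //.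
have [k1 lev1] := @exists_dyadic_level m1.+1 isT.
have [k2 lev2] := @exists_dyadic_level m2.+1 isT.
pose rho := (V / (sigma * (n1 * n2))) `^ (2 / 3).
have rho0 : 0 <= rho by exact: powR_ge0.
have AE : A = sigma ^+ 2 / n2 + sigma ^+ 2 * rho * (ln n1 `^ (1 / 3) * ln n2 `^ (2 / 3)).
  by rewrite /A powR_rate // -mulrA.
have l2h : 2^-1 <= ln n2.
  apply: le_trans (ln2_ge_half R) _; rewrite ler_ln ?posrE // ler_nat ltnS //.
have l12 : ln n2 <= ln n1 `^ (1 / 3) * ln n2 `^ (2 / 3).
  apply: ln_le_geomean; first by lra.
  by rewrite ler_ln ?posrE // ler_nat.
set L := ln n1 `^ _ * _ in AE l12.
have A0 : 0 <= A.
  have L0 : 0 <= L by rewrite mulr_ge0 ?powR_ge0.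
  rewrite AE; apply: addr_ge0; first by apply: divr_ge0; exact: ltW.
  by apply: mulr_ge0 L0; apply: mulr_ge0 rho0; exact: ltW.
(* [A < sigma ^+ 2] forces [rho * L < 1], and [L] is at least one half. *)
have rho2 : rho <= 2.
  have h1 : 0 < sigma ^+ 2 / n2 by rewrite divr_gt0.
  have h2 : sigma ^+ 2 * (rho * L) < sigma ^+ 2 * 1.
    by rewrite mulr1 mulrA; apply: le_lt_trans Av; rewrite AE lerDr ltW.
  rewrite ltr_pM2l // in h2.
  have h3 : rho * 2^-1 <= rho * L by rewrite ler_wpM2l // (le_trans l2h).
  lra.
have [s [sk sx kx]] := exists_cutoff (k1 + k2) rho2.
have Vx := cutoff_variation V0 s0 N0 sx.
apply: weaken (levels _ _ _ _ _ _ _ _ _ _ _ _ _ s0 sg mth m21 lev1 lev2 sk kx rho0 Vx (lexx _)).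
rewrite -/n1 -/n2 -/rho mulrDl -[leLHS]addr0; apply: lerD; last first.
  by apply: mulr_ge0; [exact: ler0n | exact: A0].
rewrite (mulrC 4) -[leRHS]mulrA ler_pM2l // [leRHS]mulrC AE.
have k2l : k2%:R <= 4 * L.
  apply: le_trans (level_le_ln R _ _) _; [|by case/andP: lev2 => _; exact|]; first by rewrite ltnS.
  by rewrite ler_pM2l.
rewrite [leLHS](_ : _ = sigma ^+ 2 / n2 + sigma ^+ 2 * rho * k2%:R); last first.
  by field; rewrite !gt_eqF.
rewrite [leRHS]mulrDl lerD //.
  by rewrite ler_peMr ?divr_ge0 // ?ltW // ltr1n.
rewrite -[leRHS]mulrA; apply: ler_wpM2l; last by rewrite mulrC.
by apply: mulr_ge0 rho0; exact: ltW.
Qed.
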